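(* Let $\Delta$ be a positive integer. Then there exist an integer $m_3 = m_3(\Delta)$ and an integer $n_3 = n_3(\Delta, m_3)$ such that the following holds for every $n \geq n_3$ and for every tree $T = (V,E)$ with $|V| = n$ and maximum degree $\Delta(T) \leq \Delta$. If $T$ admits a bare path of length $m_3$ such that one of its endpoints is a leaf of $T$, then Maker has a strategy to win the tree embedding game $(E(K_n), \mathcal{T}_n)$ in $n-1$ moves (of Maker).
   Context: Maker-Breaker game: Let $X$ be a finite set (the board) and $\mathcal{F} \subseteq 2^X$ a family of winning sets. In the Maker-Breaker game $(X, \mathcal{F})$, Maker and Breaker alternately claim one previously unclaimed element of $X$ per move, with Breaker going first. Maker wins as soon as she has claimed all elements of some winning set. ''Maker has a strategy to win in $k$ moves'' means that she has a strategy that, against any strategy of Breaker, ensures that she has fully claimed a winning set after making $k$ moves of her own. Tree embedding game: For a tree $T$ on $n$ vertices, the tree embedding game $(E(K_n), \mathcal{T}_n)$ is the Maker-Breaker game whose board is the edge set of the complete graph $K_n$ and whose (minimal) winning sets are the edge sets of all labeled copies of $T$ in $K_n$; so Maker wins as soon as the graph formed by her edges contains a copy of $T$. Bare path: A path of a tree $T$ is called bare if all of its interior vertices (i.e. vertices other than its two endpoints) have degree $2$ in $T$. The length of a path is its number of edges. *)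

(* Defs.v *)
From mathcomp Require Import all_boot.

Set Implicit Arguments.
Unset Strict Implicit.
Unset Printing Implicit Defensive.

Section MakerBreaker.

Variables (X : finType) (B : {set X}).

(* A history lists all claimed elements in chronological order.  Breaker moves
   first, so the entries at even indices (from 0) are his, and the entries at
   odd indices are Maker's. *)
Definition strategy := seq X -> X.

Definition unclaimed (h : seq X) : {set X} := B :\: [set x in h].

Definition legal (s : strategy) : Prop :=
  forall h, unclaimed h != set0 -> s h \in unclaimed h.

(* Once the board is exhausted, the history no longer changes. *)
Definition move (s : strategy) (h : seq X) : seq X :=
  if unclaimed h == set0 then h else rcons h (s h).

Definition play (maker breaker : strategy) (k : nat) : seq X :=
  iter k (fun h => move maker (move breaker h)) [::].

(* Under legal strategies a history has no repetition, so [index x h] is the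
   time at which x was claimed. *)
Definition maker_set (h : seq X) : {set X} := [set x in h | odd (index x h)].

Definition maker_wins_in (F : {set {set X}}) (k : nat) : Prop :=
  exists2 maker : strategy, legal maker &
    forall breaker : strategy, legal breaker ->
      exists2 A : {set X}, A \in F & A \subset maker_set (play maker breaker k).

End MakerBreaker.

Section Graphs.

Variables (V : finType) (e : rel V).

Definition simple_graph : Prop := symmetric e /\ irreflexive e.

Definition connected : Prop := forall x y, connect e x y.

(* The bound on the size excludes the closed walk x, y, x along one edge. *)
Definition acyclic : Prop := forall c : seq V, 2 < size c -> ~ ucycle e c.

Definition is_tree : Prop :=
  [/\ simple_graph, 0 < #|V|, connected & acyclic].

Definition degree (v : V) : nat := #|[set w | e v w]|.

Definition max_degree : nat := \max_(v : V) degree v.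

Definition leaf (v : V) : Prop := degree v = 1.

(* The path with vertex sequence x :: s has endpoints x and [last x s], interior
   vertices [behead (belast x s)], and [size s] edges. *)
Definition bare_path (x : V) (s : seq V) : Prop :=
  [/\ path e x s, uniq (x :: s) &
      forall v, v \in behead (belast x s) -> degree v = 2].

Definition edge_set : {set {set V}} :=
  [set [set p.1; p.2] | p : V * V & e p.1 p.2].

End Graphs.

Definition complete_edges (n : nat) : {set {set 'I_n}} :=
  [set A : {set 'I_n} | #|A| == 2].

Definition copies (V : finType) (e : rel V) (n : nat) : {set {set {set 'I_n}}} :=
  [set [set f @: A | A : {set V} in edge_set e]
     | f : {ffun V -> 'I_n} & injectiveb f].

(* Main.v *)
Require Import Defs.
From mathcomp Require Import all_boot.
From mathcomp Require Import zify.

Set Implicit Arguments.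
Unset Strict Implicit.
Unset Printing Implicit Defensive.

(** Let the pendant bare path be p = v_0, v_1, ..., v_m, with v_m a leaf, let
    Q = {v_1, ..., v_m}, and let T' be the tree T - Q, which contains p.  Maker
    first embeds T' vertex by vertex and then threads a Hamilton path, starting
    at the image of p, through the m board vertices left over.  No move is
    wasted, so n - 1 moves suffice; what has to be shown is that Breaker cannot
    concentrate his edges on the few vertices that remain.

    Embedding T'.  Call a board vertex available while it is not in the image,
    and let r(u) be the number of neighbours of an embedded vertex u that are
    not embedded yet.  The danger of a position is twice the number of
    Breaker's edges between available vertices, plus twice the sum over all u
    with r(u) > 0 of the excess of (Breaker's edges from u to available
    vertices) + r(u) over Delta + 1.  A move of Breaker raises it by at most 2
    ([danger_claim]), and Maker keeps it at most Delta^2 ([safe_move]): she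
    lowers it by 2 when she extends a vertex of positive excess, when she uses
    up an available vertex that meets another one in Breaker's graph, or one
    that Breaker joined to a vertex of positive excess.  If none of these is
    possible, then all such available vertices are among the at most Delta
    Breaker neighbours of a single embedded vertex, and the danger is at most
    Delta^2 already.  So at the end Breaker has boundedly many edges on the m
    remaining vertices, whatever n is, and m is large compared with that bound.

    The Hamilton path.  The position is now a collection of vertex-disjoint
    paths (single vertices at first), one of which has the image of p as an end
    that must not be used.  Maker joins two paths by an edge between their ends,
    and only Breaker's edges between ends of different paths matter; let E be
    their number and let s + 1 be the number of paths.  A join decreases s by 1,
    and removes Breaker's edges at the two joined ends as well as the one
    between the two outer ends.  If E < s on Maker's turn, she can remove two edges
    (or all of them) per move from then on, which suffices to win ([gain_two]).
    So it is enough to bring E below s.  If E >= s, then either some join removes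
    three edges or Breaker's edges form a matching that misses just one end.
    In the latter case almost all paths come in couples joined by two of his
    edges; Maker joins two couples, which removes two edges, and Breaker cannot
    prevent a join that removes three edges next ([join_gain_three]).  Pairing
    up single vertices costs one edge for each new path, so it keeps E - s
    bounded ([join_game_many_singles]), and then s is large enough for the
    surplus to be worked off ([join_game_ends]). *)

(** Only the numerical hypotheses bear on the arithmetic goals below. *)
Ltac nat_lia :=
  repeat match goal with
  | H : is_true (_ <= _) |- _ => revert H
  | H : @eq nat _ _ |- _ => revert H
  | H : is_true (~~ odd _) |- _ => revert H
  | H : is_true (_ <= _) \/ is_true (_ <= _) |- _ => revert H
  end; clear; lia.

(** * Positional solution of a Maker-Breaker game *)

Section PositionalGame.

Variables (X : finType) (Bd : {set X}) (F : {set {set X}}).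

(** Breaker is to move, M and B are the edges claimed so far and k rounds are
    left.  Maker may answer with an edge that she owns already: such an answer
    is replaced by an arbitrary free edge, which never hurts her.  This spares
    every later strategy from recording which edges she owns. *)
Fixpoint wins_from (k : nat) (M B : {set X}) : bool :=
  match k with
  | 0 => [exists A in F, A \subset M]
  | k'.+1 =>
    [forall b in Bd :\: (M :|: B), exists m in Bd :\: (b |: B),
       wins_from k' (m |: M) (b |: B)]
  end.

Lemma wins_from_mono k (M M' B : {set X}) :
  M \subset M' -> wins_from k M B -> wins_from k M' B.
Proof.
elim: k M M' B => [|k IHk] M M' B sMM' /=.
  case/existsP=> A /andP[FA sAM]; apply/existsP; exists A.
  by rewrite FA (subset_trans sAM).
move/forall_inP=> win; apply/forall_inP=> b b_free.
have /win/exists_inP[m m_free win_m] : b \in Bd :\: (M :|: B).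
  by apply: subsetP b_free; rewrite setDS // setSU.
apply/exists_inP; exists m => //.
by apply: IHk win_m; apply: setUS.
Qed.

Definition breaker_set (h : seq X) : {set X} :=
  [set x in h | ~~ odd (index x h)].

Lemma maker_breaker_cover (h : seq X) (x : X) :
  (x \in maker_set h) || (x \in breaker_set h) = (x \in h).
Proof. by rewrite !inE -andb_orr orbN andbT. Qed.

(** The board position can be read off a history because a claimed edge keeps
    its index when the history grows. *)
Lemma index_rcons (h : seq X) x y :
  index x (rcons h y) =
    if x \in h then index x h else if x == y then size h else (size h).+1.
Proof.
by rewrite -cats1 index_cat /= (eq_sym y); case: ifP => // _; case: ifP;
   rewrite ?addn0 ?addn1.
Qed.

Lemma maker_set_rcons (h : seq X) (y : X) : y \notin h ->
  maker_set (rcons h y) = if odd (size h) then y |: maker_set h else maker_set h.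
Proof.
move=> nhy; apply/setP=> x; case odd_h: (odd (size h)); rewrite !inE;
  rewrite mem_rcons inE index_rcons //;
  by have [->|_] := eqVneq x y; rewrite ?(negbTE nhy) /= ?odd_h //;
     case: (x \in h).
Qed.

Lemma breaker_set_rcons (h : seq X) (y : X) : y \notin h ->
  breaker_set (rcons h y) =
    if odd (size h) then breaker_set h else y |: breaker_set h.
Proof.
move=> nhy; apply/setP=> x; case odd_h: (odd (size h)); rewrite !inE;
  rewrite mem_rcons inE index_rcons //;
  by have [->|_] := eqVneq x y; rewrite ?(negbTE nhy) /= ?odd_h //;
     case: (x \in h).
Qed.

Definition positional_maker (x0 : X) (k : nat) : strategy X := fun h =>
  let B := breaker_set h in
  let any := odflt x0 [pick y in unclaimed Bd h] in
  if [pick m in Bd :\: B | wins_from (k - (size h)./2).-1 (m |: maker_set h) B]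
    is Some m then if m \in unclaimed Bd h then m else any
  else any.

Lemma positional_maker_legal x0 k : legal Bd (positional_maker x0 k).
Proof.
move=> h free; rewrite /positional_maker.
have any_ok : odflt x0 [pick y in unclaimed Bd h] \in unclaimed Bd h.
  by case: pickP => //= no_y; case/set0Pn: free => y; rewrite no_y.
by case: pickP => //= m _; case: ifP.
Qed.

Lemma unclaimed_neq0 (h : seq X) :
  uniq h -> size h < #|Bd| -> unclaimed Bd h != set0.
Proof.
move=> Uh lt_h; rewrite setD_eq0; apply: contraL lt_h => /subset_leq_card.
by rewrite -leqNgt cardsE (card_uniqP Uh).
Qed.

(** The board has room for 2k edges, so during the first k rounds it is never
    exhausted and both players do move. *)
Lemma positional_play x0 k breaker i :
    2 * k <= #|Bd| -> wins_from k set0 set0 -> legal Bd breaker -> i <= k ->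
  let h := play Bd (positional_maker x0 k) breaker i in
  [/\ size h = i.*2, uniq h
    & wins_from (k - i) (maker_set h) (breaker_set h)].
Proof.
move=> Bd_large win0 legalB; elim: i => [|i IHi] le_ik.
  by split=> //; rewrite subn0.
have [size_h Uh win_h] := IHi (ltnW le_ik).
have def_play : play Bd (positional_maker x0 k) breaker i.+1 =
  move Bd (positional_maker x0 k) (move Bd breaker
    (play Bd (positional_maker x0 k) breaker i)) by rewrite /play iterS.
move: size_h Uh win_h; rewrite {}def_play /=.
set h := play Bd _ _ i => size_h Uh win_h; clearbody h.
have free_h : unclaimed Bd h != set0.
  by apply: unclaimed_neq0; rewrite // size_h; apply: leq_trans Bd_large; nat_lia.
have -> : move Bd breaker h = rcons h (breaker h) by rewrite /move (negbTE free_h).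
have := legalB h free_h; set b := breaker h => b_free.
have [nhb Bd_b] : b \notin h /\ b \in Bd by move: b_free; rewrite !inE => /andP[].
set h' := rcons h b.
have Uh' : uniq h' by rewrite rcons_uniq nhb.
have size_h' : size h' = i.*2.+1 by rewrite size_rcons size_h.
have free_h' : unclaimed Bd h' != set0.
  by apply: unclaimed_neq0; rewrite // size_h'; apply: leq_trans Bd_large; nat_lia.
have -> : move Bd (positional_maker x0 k) h' = rcons h' (positional_maker x0 k h').
  by rewrite /move (negbTE free_h').
have := positional_maker_legal x0 k free_h'; set y := positional_maker x0 k h'.
move=> y_free.
have nh'y : y \notin h' by move: y_free; rewrite !inE => /andP[].
split; first by rewrite size_rcons size_h' doubleS.
  by rewrite rcons_uniq nh'y.
rewrite maker_set_rcons // breaker_set_rcons // size_h' /= odd_double /=.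
have defB' : breaker_set h' = b |: breaker_set h.
  by rewrite breaker_set_rcons // size_h odd_double.
have defM' : maker_set h' = maker_set h.
  by rewrite maker_set_rcons // size_h odd_double.
have [j def_j] : exists j, k - i = j.+1 by exists (k - i).-1; nat_lia.
have [m m_free win_m] : exists2 m, m \in Bd :\: breaker_set h'
    & wins_from j (m |: maker_set h') (breaker_set h').
  move: win_h; rewrite def_j /= => /forall_inP/(_ b); rewrite defB' defM'.
  case/(_ _)/exists_inP=> [|m m_free win_m]; last by exists m.
  by rewrite in_setD in_setU maker_breaker_cover nhb Bd_b.
have def_kj : (k - (size h')./2).-1 = j.
  by rewrite size_h' /= uphalf_double def_j.
have -> : k - i.+1 = j by nat_lia.
move: (erefl y); rewrite {2}/y /positional_maker def_kj.
case: pickP => [m' /andP[m'_free win_m'] def_y|/(_ m)]; last first.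
  by rewrite m_free win_m.
apply: wins_from_mono win_m'; rewrite subUset subsetUr andbT sub1set.
case: ifPn def_y => [_ -> | m'_claimed _]; first exact: setU11.
apply: setU1r; move: m'_claimed m'_free.
rewrite /unclaimed !in_setD inE => m'_claimed /andP[nBm' Bd_m'].
by move: m'_claimed; rewrite Bd_m' andbT negbK -maker_breaker_cover
  (negbTE nBm') orbF.
Qed.

Lemma wins_from_maker_wins (x0 : X) k :
  2 * k <= #|Bd| -> wins_from k set0 set0 -> maker_wins_in Bd F k.
Proof.
move=> Bd_large win0; exists (positional_maker x0 k).
  exact: positional_maker_legal.
move=> breaker legalB.
have [_ _] := positional_play x0 Bd_large win0 legalB (leqnn k).
by rewrite subnn => /exists_inP.
Qed.

End PositionalGame.

(** * Claimed edges and counting adjacent pairs *)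

Definition adj (T : finType) (B : {set {set T}}) (u v : T) : bool :=
  (u != v) && ([set u; v] \in B).

Section Adjacency.

Variables (T : finType) (B : {set {set T}}).

Lemma adjC u v : adj B u v = adj B v u.
Proof. by rewrite /adj eq_sym setUC. Qed.

Lemma adj_irr u : adj B u u = false.
Proof. by rewrite /adj eqxx. Qed.

Lemma set2_eq (a b c d : T) :
  [set a; b] = [set c; d] -> (a = c /\ b = d) \/ (a = d /\ b = c).
Proof.
move=> eq_s.
have [ain bin cin din] : [/\ a \in [set c; d], b \in [set c; d],
    c \in [set a; b] & d \in [set a; b]].
  by split; rewrite (eq_s, esym eq_s) ?set21 ?set22 // -eq_s ?set21 ?set22.
move: ain bin cin din; rewrite !inE.
by do 4![case/orP=> /eqP ?]; subst; auto.
Qed.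

Lemma adj_setU1 b u v : adj (b |: B) u v = adj B u v || (u != v) && ([set u; v] == b).
Proof. by rewrite /adj in_setU1 andb_orr orbC. Qed.

Lemma adjS (B' : {set {set T}}) u v : B \subset B' -> adj B u v -> adj B' u v.
Proof. by rewrite /adj => sBB' /andP[-> /(subsetP sBB') ->]. Qed.

End Adjacency.

Section RelationCounting.

Variable T : finType.
Implicit Type h : rel T.

Definition pairs h : nat := #|[set p : T * T | h p.1 p.2]|.

Definition deg h (u : T) : nat := #|[set w | h u w]|.

Lemma card_sum_bool (I : finType) (P : pred I) : #|[set i | P i]| = \sum_i (P i : nat).
Proof. by rewrite -sum1_card big_mkcond; apply: eq_bigr => i _; rewrite inE; case: (P i). Qed.

Lemma card_mem_sum (I : finType) (A : {set I}) : #|A| = \sum_i (i \in A : nat).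
Proof. by rewrite -card_sum_bool; apply: eq_card => i; rewrite inE. Qed.

Lemma pairs_sum h : pairs h = \sum_u \sum_v (h u v : nat).
Proof.
by rewrite /pairs card_sum_bool
  (pair_bigA addn (fun u v => nat_of_bool (h u v))).
Qed.

Lemma deg_sum h u : deg h u = \sum_v (h u v : nat).
Proof. exact: card_sum_bool. Qed.

Lemma pairs_deg h : pairs h = \sum_u deg h u.
Proof. by rewrite pairs_sum; apply: eq_bigr => u _; rewrite deg_sum. Qed.

(** Evenness makes the bounds on Breaker's edges sharp: [pairs] counts every
    edge twice, so 2s - 1 < pairs <= 2s + 1 pins it down to 2s. *)
Lemma pairs_even h : symmetric h -> irreflexive h -> ~~ odd (pairs h).
Proof.
move=> sym_h irr_h.
pose P b := [set p : T * T | h p.1 p.2 && ((enum_rank p.1 < enum_rank p.2) == b)].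
have -> : pairs h = #|P true| + #|P false|.
  rewrite /pairs /P -(cardsID [set p | enum_rank p.1 < enum_rank p.2]).
  by congr (_ + _); apply: eq_card => p; rewrite !inE andbC; case: (_ < _);
     rewrite ?andbT ?andbF.
have -> : P false = [set (p.2, p.1) | p in P true].
  apply/setP=> [[u v]]; rewrite !inE /=; apply/andP/imsetP=> [[huv lt_uv]|].
    exists (v, u); rewrite // inE /= sym_h huv eqb_id ltn_neqAle leqNgt.
    rewrite (eqP lt_uv) andbT; apply: contraTneq huv => eq_r.
    by rewrite (enum_rank_inj (val_inj eq_r)) irr_h.
  case=> [[u' v']]; rewrite inE /= => /andP[huv lt_uv] [-> ->].
  by rewrite sym_h huv eqbF_neg -leqNgt ltnW // (eqP lt_uv).
rewrite card_imset ?addnn ?odd_double //.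
by move=> [u v] [u' v'] [-> ->].
Qed.

Lemma pairs_sub h h' : subrel h h' -> pairs h <= pairs h'.
Proof.
by move=> sub; apply/subset_leq_card/subsetP=> p; rewrite !inE; apply: sub.
Qed.

Lemma deg_gt0 h u : (0 < deg h u) = [exists v, h u v].
Proof.
by apply/card_gt0P/existsP=> [] [v]; rewrite ?inE => huv; exists v; rewrite ?inE.
Qed.

Lemma row_sum h c : \sum_y \sum_w ([&& y == c & h y w] : nat) = deg h c.
Proof.
rewrite (bigD1 c) //= [X in _ + X]big1 ?addn0 ?eqxx ?deg_sum //.
by move=> y /negbTE->; rewrite big1.
Qed.

Lemma col_sum h c : symmetric h ->
  \sum_y \sum_w ([&& w == c & h y w] : nat) = deg h c.
Proof.
by move=> sym_h; rewrite exchange_big -[RHS]row_sum;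
   do 2!apply: eq_bigr => ? _; rewrite sym_h.
Qed.

Lemma pairs_remove h h' a : symmetric h -> irreflexive h -> subrel h' h ->
    (forall w, ~~ h' a w) -> (forall w, ~~ h' w a) ->
  pairs h' + (deg h a).*2 <= pairs h.
Proof.
move=> sym_h irr_h sub no_row no_col.
rewrite -addnn -{1}row_sum -(col_sum _ sym_h) addnA !pairs_sum -!big_split /=.
apply: leq_sum => y _; rewrite -!big_split; apply: leq_sum => w _ /=.
have [->|_] := eqVneq y a.
  rewrite (negbTE (no_row w)) /=; have [->|_] := eqVneq w a; first by rewrite irr_h.
  by rewrite addn0.
have [->|_] := eqVneq w a; first by rewrite (negbTE (no_col y)).
by rewrite !addn0; case h'_yw: (h' y w); rewrite // (sub _ _ h'_yw).
Qed.

Lemma pairs_add_edge h h' (b : {set T}) :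
    (forall c d, h' c d -> h c d || ([set c; d] == b)) ->
  pairs h' <= pairs h + 2.
Proof.
move=> new_h'.
case: (pickP [pred p | h' p.1 p.2 && ~~ h p.1 p.2]) => [[c d]|no_new].
  case/andP=> /= h'cd nhcd; have := new_h' c d h'cd; rewrite (negbTE nhcd) /=.
  move/eqP=> def_b; have: #|[set (c, d); (d, c)]| <= 2 by rewrite cards2; case: (_ != _).
  rewrite /pairs; set N := [set (c, d); (d, c)] => card_N.
  set P := [set p | h p.1 p.2].
  apply: (@leq_trans #|P :|: N|); last first.
    by apply: leq_trans (leq_card_setU _ _) _; rewrite leq_add2l.
  apply/subset_leq_card/subsetP=> [[c' d']].
  rewrite inE in_setU [_ \in P]inE /= => /new_h'/orP[-> //|/eqP].
  by rewrite -def_b => /set2_eq[[-> ->]|[-> ->]]; rewrite !inE eqxx !orbT.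
apply: leq_trans (leq_addr _ _); apply: pairs_sub => c d h_cd.
by have /= := no_new (c, d); rewrite h_cd /= => /negbFE.
Qed.

Lemma deg_pairs h u : symmetric h -> irreflexive h -> (deg h u).*2 <= pairs h.
Proof.
move=> sym_h irr_h; apply: leq_trans (leq_addl (pairs (fun _ _ => false)) _) _.
exact: pairs_remove.
Qed.

End RelationCounting.

(** * Joining path ends *)

Section Joining.

Variable T : finType.
Implicit Types (B : {set {set T}}) (Z : {set T}) (pi : T -> T) (z : T).

(** A collection of vertex-disjoint paths is represented by the set [Z] of
    their ends and the map [pi] from an end to the other end of its path; a
    single vertex is its own mate.  The end [z] is the image of p, which already
    has all its other tree edges and must stay an end. *)
Definition linking Z pi z : Prop :=
  [/\ {in Z, forall u, pi u \in Z}, {in Z, forall u, pi (pi u) = u},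
      z \in Z & pi z != z].

(** Breaker's edges that can still hurt Maker: those between usable ends of
    different paths. *)
Definition cross B Z pi z : rel T := fun u v =>
  [&& u \in Z :\ z, v \in Z :\ z, v != pi u & adj B u v].

Definition joinable B Z pi z u v : bool :=
  [&& u \in Z :\ z, v \in Z :\ z, v != u, v != pi u & ~~ adj B u v].

(** If u is a single vertex, then [pi u = u] and u stays an end. *)
Definition join_ends Z pi u v : {set T} :=
  (Z :\: [set u; v]) :|: [set pi u; pi v].

Definition join_mate pi u v : T -> T := fun y =>
  if y == pi v then pi u else if y == pi u then pi v else pi y.

Lemma cross_sym B Z pi z : linking Z pi z -> symmetric (cross B Z pi z).
Proof.
case=> piZ piK _ _ u v; rewrite /cross adjC.
suff: v \in Z -> u \in Z -> (v != pi u) = (u != pi v).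
  by rewrite !in_setD1; case: (v \in Z); case: (u \in Z); rewrite ?andbF //= => ->;
     rewrite // andbCA.
by move=> Zv Zu; congr (~~ _); apply/eqP/eqP=> ->; rewrite piK.
Qed.

Lemma cross_irr B Z pi z : irreflexive (cross B Z pi z).
Proof. by move=> u; rewrite /cross adj_irr !andbF. Qed.

Section OneJoin.

Variables (B : {set {set T}}) (Z : {set T}) (pi : T -> T) (z u v : T).
Hypotheses (linkZ : linking Z pi z) (join_uv : joinable B Z pi z u v).

Let piZ : {in Z, forall u, pi u \in Z}. Proof. by case: linkZ. Qed.
Let piK : {in Z, forall u, pi (pi u) = u}. Proof. by case: linkZ. Qed.
Let Zz : z \in Z. Proof. by case: linkZ. Qed.
Let piz : pi z != z. Proof. by case: linkZ. Qed.
Let Zu : u \in Z. Proof. by case/and5P: join_uv => /setD1P[]. Qed.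
Let Zv : v \in Z. Proof. by case/and5P: join_uv => _ /setD1P[]. Qed.
Let nzu : u != z. Proof. by case/and5P: join_uv => /setD1P[]. Qed.
Let nzv : v != z. Proof. by case/and5P: join_uv => _ /setD1P[]. Qed.
Let nvu : v != u. Proof. by case/and5P: join_uv. Qed.
Let nvpu : v != pi u. Proof. by case/and5P: join_uv. Qed.
Let nadj : ~~ adj B u v. Proof. by case/and5P: join_uv. Qed.

Lemma mate_inj y w : y \in Z -> w \in Z -> (pi y == pi w) = (y == w).
Proof.
by move=> Zy Zw; apply/eqP/eqP=> [eq_p|-> //]; rewrite -(piK Zy) eq_p piK.
Qed.

Let nupv : u != pi v.
Proof. by apply: contra nvpu => /eqP->; rewrite piK. Qed.

Lemma join_linking : linking (join_ends Z pi u v) (join_mate pi u v) z.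
Proof.
have memZ y : (y \in join_ends Z pi u v) =
    [|| y == pi u, y == pi v | [&& y != u, y != v & y \in Z]].
  by rewrite !inE negb_or -andbA orbC orbA.
have npuv : pi u == pi v = false by rewrite mate_inj // eq_sym (negbTE nvu).
split=> [y|y||]; rewrite ?memZ /join_mate.
- case: (eqVneq y (pi v)) => [->|nypv]; first by rewrite eqxx.
  case: (eqVneq y (pi u)) => [->|nypu] /=; first by rewrite eqxx orbT.
  case/and3P=> nyu nyv Zy; rewrite !mate_inj // (negbTE nyu) (negbTE nyv) /=.
  rewrite piZ // andbT; apply/andP; split.
    by apply: contra nypu => /eqP <-; rewrite piK.
  by apply: contra nypv => /eqP <-; rewrite piK.
- case: (eqVneq y (pi v)) => [->|nypv]; first by rewrite npuv eqxx.
  case: (eqVneq y (pi u)) => [->|nypu] /=; first by rewrite eqxx.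
  case/and3P=> nyu nyv Zy; rewrite !mate_inj // (negbTE nyu) (negbTE nyv).
  exact: piK.
- by rewrite (eq_sym z u) (eq_sym z v) nzu nzv Zz !orbT.
- case: (eqVneq z (pi v)) => [->|nzpv]; first by rewrite npuv.
  by case: (eqVneq z (pi u)) => [->|nzpu]; rewrite // eq_sym npuv.
Qed.

(** No edge becomes dangerous by a join: the ends that survive were ends before,
    and two ends of the same path remain so. *)
Lemma cross_join :
  subrel (cross B (join_ends Z pi u v) (join_mate pi u v) z) (cross B Z pi z).
Proof.
have subZ y : y \in join_ends Z pi u v -> y \in Z.
  by rewrite !inE => /orP[/andP[]//|/orP[]/eqP->]; apply: piZ.
move=> c d /and4P[/setD1P[ncz Zc] /setD1P[ndz Zd] ndc adj_cd].
rewrite /cross !in_setD1 ncz ndz !subZ //= adj_cd andbT.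
apply: contraTneq adj_cd => def_d; apply/negP=> /andP[ncd _].
have Zc' := subZ c Zc; have Zd' := subZ d Zd.
move: ndc; rewrite /join_mate.
case: (eqVneq c (pi v)) => [def_c|ncpv].
  have dv : d = v by rewrite def_d def_c piK.
  move: Zd; rewrite dv !inE eqxx orbT /= => /orP[/eqP vpu|/eqP vpv].
    by case/eqP: nvpu.
  by rewrite dv def_c -vpv eqxx in ncd.
case: (eqVneq c (pi u)) => [def_c|ncpu]; last by rewrite def_d eqxx.
have du : d = u by rewrite def_d def_c piK.
move: Zd; rewrite du !inE eqxx /= => /orP[/eqP upu|/eqP upv].
  by rewrite du def_c -upu eqxx in ncd.
by case/eqP: nupv.
Qed.

Definition singles Z pi := [set y in Z | pi y == y].

(** Counting a single vertex twice, the number of ends is twice the number of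
    paths, which drops by one. *)
Lemma join_card :
  #|join_ends Z pi u v| + #|singles (join_ends Z pi u v) (join_mate pi u v)| + 2
    = #|Z| + #|singles Z pi|.
Proof.
have point y : (y \in join_ends Z pi u v)
      + (y \in singles (join_ends Z pi u v) (join_mate pi u v))
      + (y == u) + (y == v) = (y \in Z) + (y \in singles Z pi).
  have npuv : pi u == pi v = false by rewrite mate_inj // eq_sym (negbTE nvu).
  rewrite !inE /join_mate.
  have [->|nyu] := eqVneq y u.
    rewrite (negbTE nupv) (eq_sym u v) (negbTE nvu) Zu /=.
    rewrite (eq_sym u (pi u)); case: eqP => [pu|] //=.
    by rewrite eq_sym (negbTE nupv).
  have [->|nyv] := eqVneq y v.
    rewrite (negbTE nvpu) Zv /= (eq_sym v (pi v)); case: eqP => //= _.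
    by rewrite eq_sym (negbTE nvpu).
  have [def_y|nypu] := eqVneq y (pi u).
    by rewrite def_y npuv piK // piZ //= eq_sym npuv (eq_sym u) -def_y (negbTE nyu) .
  have [def_y|nypv] := eqVneq y (pi v); last by rewrite /= orbF !addn0.
  by rewrite def_y piK // piZ //= npuv (eq_sym v) -def_y (negbTE nyv).
have one c : \sum_y ((y == c) : nat) = 1.
  by rewrite (bigD1 c) //= eqxx big1 // => y /negbTE->.
rewrite !card_mem_sum -!big_split /=.
rewrite -(eq_bigr _ (fun y _ => point y)) !big_split /= !one; nat_lia.
Qed.

(** A join disposes of Breaker's edges at [u] and [v], which become inner
    vertices, and of an edge between [pi u] and [pi v], which become the two
    ends of one path. *)
Lemma join_gain : pi u != u -> pi v != v ->
  pairs (cross B (join_ends Z pi u v) (join_mate pi u v) z)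
   + (deg (cross B Z pi z) u + deg (cross B Z pi z) v
      + cross B Z pi z (pi u) (pi v)).*2 <= pairs (cross B Z pi z).
Proof.
move=> npu npv; set h := cross B Z pi z; set h' := cross _ _ _ _.
have sym_h : symmetric h by apply: cross_sym.
have sub_h : subrel h' h by apply: cross_join.
pose t1 y w := [&& y == u & h y w]; pose t2 y w := [&& y == v & h y w].
pose t3 y w := [&& w == u & h y w]; pose t4 y w := [&& w == v & h y w].
pose t5 y w := [&& y == pi u, w == pi v & h y w].
pose t6 y w := [&& y == pi v, w == pi u & h y w].
have point y w : h' y w + t1 y w + t2 y w + t3 y w + t4 y w + t5 y w + t6 y w
    <= h y w.
  rewrite /t1 /t2 /t3 /t4 /t5 /t6.
  case h_yw: (h y w); last first.
    rewrite !andbF !addn0; case h'_yw: (h' y w) => //.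
    by rewrite (sub_h _ _ h'_yw) in h_yw.
  rewrite !andbT.
  have h'P : h' y w -> [&& y != u, y != v, w != u, w != v & (w != join_mate pi u v y)].
    case/and4P=> /setD1P[_] Zy /setD1P[_] Zw nwy _; rewrite nwy andbT.
    have nuZ : u \notin join_ends Z pi u v.
      by rewrite !inE eqxx /= eq_sym (negbTE npu) (negbTE nupv).
    have nvZ : v \notin join_ends Z pi u v.
      by rewrite !inE eqxx orbT /= (negbTE nvpu) eq_sym (negbTE npv).
    have nU c : c \in join_ends Z pi u v -> c != u.
      by move=> Zc; apply: contraNneq nuZ => def_c; rewrite def_c in Zc.
    have nV c : c \in join_ends Z pi u v -> c != v.
      by move=> Zc; apply: contraNneq nvZ => def_c; rewrite def_c in Zc.
    by rewrite !nU ?nV.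
  have npuv : pi u == pi v = false by rewrite mate_inj // eq_sym (negbTE nvu).
  have nhuv : h u v = false by rewrite /h /cross (negbTE nadj) !andbF.
  have nhvu : h v u = false by rewrite sym_h.
  have nh_irr c : h c c = false by apply: cross_irr.
  have nvu' : u == v = false by rewrite eq_sym (negbTE nvu).
  have npu' : u == pi u = false by rewrite eq_sym (negbTE npu).
  have npv' : v == pi v = false by rewrite eq_sym (negbTE npv).
  have [yu|nyu] := eqVneq y u.
    rewrite yu in h_yw h'P *; rewrite eqxx in h'P.
    have [wu|nwu] := eqVneq w u; first by rewrite wu nh_irr in h_yw.
    have [wv|nwv] := eqVneq w v; first by rewrite wv nhuv in h_yw.
    rewrite nvu' npu' (negbTE nupv) /=; case: (h' u w) h'P => //.
    by move=> /(_ isT).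
  have [yv|nyv] := eqVneq y v.
    rewrite yv in h_yw h'P *; rewrite eqxx andbF in h'P.
    have [wu|nwu] := eqVneq w u; first by rewrite wu nhvu in h_yw.
    have [wv|nwv] := eqVneq w v; first by rewrite wv nh_irr in h_yw.
    rewrite npv' (negbTE nvpu) /=; case: (h' v w) h'P => //.
    by move=> /(_ isT).
  have [wu|nwu] := eqVneq w u.
    rewrite wu in h_yw h'P *; rewrite eqxx !andbF in h'P.
    rewrite nvu' npu' (negbTE nupv) !andbF /=; case: (h' y u) h'P => //.
    by move=> /(_ isT).
  have [wv|nwv] := eqVneq w v.
    rewrite wv in h_yw h'P *; rewrite eqxx !andbF in h'P.
    rewrite npv' (negbTE nvpu) !andbF /=; case: (h' y v) h'P => //.
    by move=> /(_ isT).
  rewrite /= !addn0; case: (h' y w) h'P => [/(_ isT)|_]; last first.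
    by case: eqP => [->|_] /=; rewrite ?npuv ?addn0 ?leq_b1 //; case: (_ && _).
  rewrite nyu nyv nwu nwv /= /join_mate.
  case: (eqVneq y (pi v)) => [->|nypv]; first by rewrite (eq_sym (pi v)) npuv => /negbTE->.
  by case: (eqVneq y (pi u)) => [_|nypu] // /negbTE->.
have le_sum : \sum_y \sum_w (h' y w + t1 y w + t2 y w + t3 y w + t4 y w
    + t5 y w + t6 y w) <= pairs h.
  by rewrite pairs_sum; do 2!apply: leq_sum => ? _; apply: point.
apply: leq_trans le_sum.
have cell c d : \sum_y \sum_w ([&& y == c, w == d & h y w] : nat) = h c d.
  rewrite (bigD1 c) //= [X in _ + X]big1 ?addn0; last first.
    by move=> y /negbTE->; rewrite big1.
  rewrite (bigD1 d) //= [X in _ + X]big1 ?addn0 ?eqxx //.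
  by move=> y /negbTE->; rewrite andbF.
under eq_bigr do rewrite !big_split /=.
rewrite !big_split /= -pairs_sum !(row_sum h) !(col_sum _ sym_h) !cell (sym_h (pi v)); nat_lia.
Qed.

End OneJoin.

Lemma pairs_claim B Z pi z b :
  pairs (cross (b |: B) Z pi z) <= pairs (cross B Z pi z) + 2.
Proof.
apply: (@pairs_add_edge _ _ _ b) => c d /and4P[Zc Zd ndc]; rewrite adj_setU1.
by rewrite /cross Zc Zd ndc => /orP[->//|/andP[_ ->]]; rewrite orbT.
Qed.

End Joining.

(** * Winning the joining game *)

Section JoinGame.

Variable T : finType.
Implicit Types (B : {set {set T}}) (Z : {set T}) (pi : T -> T) (z : T).

(** Maker is to move and must make k joins, after each of which Breaker claims
    an edge.  She wins when the path ending at [z] is the only one left. *)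
Fixpoint join_game (k : nat) B Z pi z : Prop :=
  match k with
  | 0 => Z \subset [set z; pi z]
  | k'.+1 => exists u v, joinable B Z pi z u v /\
      forall b, join_game k' (b |: B) (join_ends Z pi u v) (join_mate pi u v) z
  end.

Lemma joinableE B Z pi z u v :
  joinable B Z pi z u v =
    [&& u \in Z :\ z, v \in Z :\ z, v != u, v != pi u & ~~ cross B Z pi z u v].
Proof.
rewrite /joinable /cross; case: (u \in _) => //; case: (v \in _) => //.
by case: (v != u) => //; case: (v != pi u).
Qed.

Lemma joinable_exists B Z pi z u : u \in Z :\ z ->
    #|[set z; u; pi u]| + deg (cross B Z pi z) u < #|Z| ->
  exists v, joinable B Z pi z u v.
Proof.
move=> Zu lt_Z; set N := [set w | cross B Z pi z u w].
have /subsetPn[v Zv nv] : ~~ (Z \subset [set z; u; pi u] :|: N).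
  apply: contraL lt_Z => /subset_leq_card le_Z; rewrite -leqNgt.
  by apply: leq_trans le_Z (leq_card_setU _ _).
move: nv; rewrite !inE !negb_or => /andP[/andP[/andP[nvz nvu] nvpu] nuv].
by exists v; rewrite joinableE Zu !inE nvz Zv nvu nvpu nuv.
Qed.

Lemma card_set3 (a b c : T) : #|[set a; b; c]| <= 3.
Proof.
apply: leq_trans (leq_card_setU _ _) _.
by rewrite cards1 addn1 ltnS cards2; case: (_ != _).
Qed.

Section Gains.

Variables (B : {set {set T}}) (Z : {set T}) (pi : T -> T) (z : T).
Hypotheses (linkZ : linking Z pi z) (paired : singles Z pi = set0).

Local Notation h := (cross B Z pi z).
Local Notation D := (pairs h).
Local Notation joined u v :=
  (pairs (cross B (join_ends Z pi u v) (join_mate pi u v) z)).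

Let sym_h : symmetric h. Proof. exact: cross_sym. Qed.
Let irr_h : irreflexive h. Proof. exact: cross_irr. Qed.

Lemma paired_neq u : u \in Z -> pi u != u.
Proof.
by move=> Zu; have := in_set0 u; rewrite -paired inE Zu => /= ->.
Qed.

Lemma joinable_gain u v : joinable B Z pi z u v ->
  joined u v + (deg h u + deg h v + h (pi u) (pi v)).*2 <= D.
Proof.
move=> juv; apply: join_gain => //; apply: paired_neq.
  by case/and5P: juv => /setD1P[].
by case/and5P: juv => _ /setD1P[].
Qed.

Lemma joined_le u v : joinable B Z pi z u v -> joined u v <= D.
Proof. by move=> juv; apply: pairs_sub; apply: cross_join. Qed.

Lemma deg_ends u : 0 < deg h u -> u \in Z :\ z.
Proof. by rewrite deg_gt0 => /existsP[v /and4P[]]. Qed.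

Lemma deg_le1_inj u a b : deg h u <= 1 -> h u a -> h u b -> a = b.
Proof. by move=> /card_le1_eqP le1 hua hub; apply: le1; rewrite inE. Qed.

Lemma deg_mem u v : h u v -> 0 < deg h u.
Proof. by rewrite deg_gt0 => huv; apply/existsP; exists v. Qed.

(** An end with two Breaker edges can be joined to some other path.  Otherwise
    his edges form a matching; join an end of one edge to an end of another one,
    chosen in a different path.  With a single edge left, the truncated
    subtraction asks for its removal only. *)
Lemma gain_two k : 2 <= k -> #|Z| = k.*2.+2 -> D <= (k.-1).*2 ->
  exists u v, joinable B Z pi z u v /\ joined u v <= D - 4.
Proof.
move=> k_ge2 card_Z D_small.
have cand u : u \in Z :\ z -> exists v, joinable B Z pi z u v.
  move=> Zu; apply: joinable_exists => //.
  have := card_set3 z u (pi u); have := deg_pairs u sym_h irr_h; nat_lia.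
case: (boolP [exists u, 1 < deg h u]) => [/existsP[u deg_u]|].
  have [v juv] := cand u (deg_ends (ltnW deg_u)).
  by exists u, v; split=> //; have := joinable_gain juv; nat_lia.
rewrite negb_exists => /forallP deg_le.
have deg_le1 u : deg h u <= 1 by rewrite leqNgt.
case: (boolP [exists u, 0 < deg h u]) => [/existsP[u deg_u]|]; last first.
  rewrite negb_exists => /forallP deg0; have [Zpz piK _ npz] := linkZ.
  have [|v juv] := cand (pi z); first by rewrite in_setD1 npz; apply: Zpz; case: linkZ.
  exists (pi z), v; split=> //.
  suff D0 : D = 0 by have := joined_le juv; nat_lia.
  rewrite pairs_deg big1 // => u _; apply/eqP.
  by rewrite -leqn0 leqNgt; apply: deg0.
have [w huw] : exists w, h u w by apply/existsP; rewrite -deg_gt0.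
case: (boolP [exists c, [&& 0 < deg h c, c != u & c != w]]) => [|no_c].
  case/existsP=> c /and3P[deg_c ncu ncw].
  have [d hcd] : exists d, h c d by apply/existsP; rewrite -deg_gt0.
  have nuc : ~~ h u c.
    by apply: contra ncw => huc; rewrite (deg_le1_inj (deg_le1 u) huw huc).
  have ndu : d != u by apply: contraTneq hcd => ->; rewrite sym_h.
  have nud : ~~ h u d.
    apply/negP=> hud; move: (hcd); rewrite sym_h => hdc.
    by rewrite sym_h in hud; rewrite (deg_le1_inj (deg_le1 d) hdc hud) eqxx in ncu.
  have join_with v : 0 < deg h v -> v != u -> v != pi u -> ~~ h u v ->
      exists u v, joinable B Z pi z u v /\ joined u v <= D - 4.
    move=> deg_v nvu nvpu nuv.
    have juv : joinable B Z pi z u v by rewrite joinableE !deg_ends // nvu nvpu.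
    by exists u, v; split=> //; have := joinable_gain juv; nat_lia.
  have [cpu|ncpu] := eqVneq c (pi u); last exact: (join_with c).
  apply: (join_with d) => //; first by apply: (@deg_mem d c); rewrite sym_h.
  by apply: contraTneq hcd => ->; rewrite cpu irr_h.
have [v juv] := cand u (deg_ends deg_u).
exists u, v; split=> //.
suff : D <= 2 by have := joinable_gain juv; nat_lia.
apply: (@leq_trans (\sum_(c in [set u; w]) 1)).
  rewrite pairs_deg [X in _ <= X]big_mkcond; apply: leq_sum => c _.
  case: ifPn => [_|]; first exact: deg_le1.
  rewrite !inE negb_or => /andP[ncu ncw]; rewrite leqNgt; apply: contra no_c => deg_c.
  by apply/existsP; exists c; rewrite deg_c ncu.
by rewrite sum1_card cards2; case: (_ != _).
Qed.

(** An end with three Breaker edges can be joined to some other path.  If there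
    is none, then u, its mate and its two neighbours account for at most 8, and
    u can be joined to some other end that has a Breaker edge of its own. *)
Lemma gain_three_of_deg k u : #|Z| = k.*2.+2 -> 8 < D -> D < k.*2.-1.*2 ->
    1 < deg h u ->
  exists u v, joinable B Z pi z u v /\ joined u v + 6 <= D.
Proof.
move=> card_Z D_gt D_lt deg_u.
have cand c : c \in Z :\ z -> exists v, joinable B Z pi z c v.
  move=> Zc; apply: joinable_exists => //.
  have := card_set3 z c (pi c); have := deg_pairs c sym_h irr_h; nat_lia.
case: (boolP [exists c, 2 < deg h c]) => [/existsP[c deg_c]|].
  have [v jcv] := cand c (deg_ends (ltnW (ltnW deg_c))).
  by exists c, v; split=> //; have := joinable_gain jcv; nat_lia.
rewrite negb_exists => /forallP deg_le.
have deg_le2 c : deg h c <= 2 by rewrite leqNgt.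
pose N := [set u; pi u] :|: [set w | h u w].
case: (boolP [exists c, (0 < deg h c) && (c \notin N)]) => [|no_c].
  case/existsP=> c /andP[deg_c]; rewrite !inE !negb_or => /andP[/andP[ncu ncpu] nuc].
  have juc : joinable B Z pi z u c.
    by rewrite joinableE !deg_ends ?ncu ?ncpu // ltnW.
  by exists u, c; split=> //; have := joinable_gain juc; nat_lia.
have card_N : #|N| <= 4.
  apply: leq_trans (leq_card_setU _ _) _.
  by have := deg_le2 u; rewrite /deg cards2; case: (_ != _) => /=; nat_lia.
suff : D <= #|N| * 2 by nat_lia.
rewrite -sum_nat_const pairs_deg [X in _ <= X]big_mkcond; apply: leq_sum => c _.
case: ifPn => [_|nNc]; first exact: deg_le2.
rewrite leqNgt; apply: contra no_c => deg_c.
by apply/existsP; exists c; rewrite deg_c.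
Qed.

(** In a matching, joining a and b removes the edges at a and at b, and the
    edge between their mates becomes harmless. *)
Lemma gain_three_at a c b : {in Z, forall y, deg h y <= 1} ->
    h a c -> 0 < deg h b -> b != a -> b != pi a -> b != c -> h (pi a) (pi b) ->
  joinable B Z pi z a b /\ joined a b + 6 <= D.
Proof.
move=> deg_le1 hac deg_b nba nbpa nbc hpab.
have Za := deg_ends (deg_mem hac).
have jab : joinable B Z pi z a b.
  rewrite joinableE Za deg_ends // nba nbpa /=; apply: contra nbc => hab.
  rewrite (deg_le1_inj _ hab hac) //; apply: deg_le1.
  by case/setD1P: Za.
split=> //; have := joinable_gain jab; rewrite hpab.
by have := deg_mem hac; nat_lia.
Qed.

(** The critical position.  When no join removes three edges, each edge g g'
    is accompanied by an edge between the mates of g and g', since otherwise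
    joining these mates would remove three edges.  The excluded ends are those
    for which one of the four ends involved is [z] or the single end u0 that
    Breaker's matching misses. *)
Lemma doubled_pieces k : #|Z| = k.*2.+2 -> k.*2 <= D ->
    {in Z, forall y, deg h y <= 1} ->
    (forall u v, joinable B Z pi z u v -> D < joined u v + 6) ->
  D = k.*2 /\
  exists excl : {set T}, #|excl| <= 5 /\
    {in Z :\ z, forall g, g \notin excl ->
      exists g', [/\ h g g', h (pi g) (pi g') & pi g' != z]}.
Proof.
move=> card_Z D_ge deg_le1 no_gain.
have [piZ piK Zz npz] := linkZ.
have card_W : #|Z :\ z| = k.*2.+1 by have := cardsD1 z Z; rewrite Zz; nat_lia.
pose U := [set y in Z :\ z | deg h y == 0].
have D_card : D + #|U| = k.*2.+1.
  rewrite -card_W pairs_deg !card_mem_sum -big_split.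
  apply: eq_bigr => y _ /=; rewrite /U [in LHS]inE.
  case: (boolP (y \in Z :\ z)) => [Wy|nWy] /=.
    have := deg_le1 y (proj2 (setD1P Wy)); case: (deg h y) => [|[|]] //.
  by rewrite addn0; apply/eqP; rewrite -leqn0 leqNgt; apply: contra nWy => /deg_ends.
have D_even : ~~ odd D by apply: pairs_even.
have D_eq : D = k.*2 by nat_lia.
split=> //.
have /cards1P[u0 defU] : #|U| == 1 by nat_lia.
have deg_gt y : y \in Z :\ z -> y != u0 -> 0 < deg h y.
  move=> Wy; apply: contraR; rewrite -eqn0Ngt => deg_y.
  by rewrite -in_set1 -defU !inE in Wy *; rewrite Wy.
(* The end that Breaker's matching assigns to y. *)
pose mt y := odflt y [pick w | h y w].
have mtP y w : y \in Z -> h y w -> mt y = w.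
  move=> Zy hyw; rewrite /mt; case: pickP => [w' hyw'|/(_ w)]; last by rewrite hyw.
  exact: (deg_le1_inj (deg_le1 y Zy)).
have mt_h y : 0 < deg h y -> h y (mt y).
  by rewrite deg_gt0 /mt => /existsP[w hyw]; case: pickP => [//|/(_ w)]; rewrite hyw.
exists [set pi z; u0; pi u0; mt (pi z); mt (pi u0)]; split.
  apply: leq_trans (leq_card_setU _ _) _; rewrite cards1 addn1 ltnS.
  apply: leq_trans (leq_card_setU _ _) _; rewrite cards1 addn1 ltnS.
  exact: card_set3.
have Zu0 : u0 \in Z by have := set11 u0; rewrite -defU !inE => /andP[/andP[_ ->]].
move=> g Wg; rewrite !inE !negb_or -!andbA => /and5P[ngx ngu ngpu ngmx ngmu].
have [nzg Zg] := setD1P Wg.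
have npgz : pi g != z by apply: contra ngx => /eqP <-; rewrite piK.
have hgg' := mt_h g (deg_gt g Wg ngu).
exists (mt g); set g' := mt g in hgg' *.
have Wg' : g' \in Z :\ z by case/and4P: hgg'.
have [nzg' Zg'] := setD1P Wg'.
have hg'g : h g' g by rewrite sym_h.
have npg'z : pi g' != z.
  apply: contra ngmx => /eqP def_z; have -> : pi z = g' by rewrite -def_z piK.
  by rewrite (mtP _ _ Zg' hg'g).
have npg'u : pi g' != u0.
  by apply: contra ngmu => /eqP <-; rewrite piK // (mtP _ _ Zg' hg'g).
have npgu : pi g != u0 by apply: contra ngpu => /eqP <-; rewrite piK.
have Wpg : pi g \in Z :\ z by rewrite in_setD1 npgz piZ.
have Wpg' : pi g' \in Z :\ z by rewrite in_setD1 npg'z piZ.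
split=> //; apply/negPn/negP=> nh.
have npg'g' : pi g' != pi (pi g).
  rewrite piK //; apply: contraTneq hgg' => def_g; rewrite -{}def_g.
  by apply/negP=> /and4P[_ _ /eqP]; rewrite piK.
have npg'pg : pi g' != pi g.
  by apply: contraTneq hgg' => /(congr1 pi); rewrite !piK // => ->; rewrite irr_h.
have juv : joinable B Z pi z (pi g) (pi g').
  by rewrite joinableE Wpg Wpg' npg'g' npg'pg.
have := no_gain _ _ juv; have := joinable_gain juv.
have := deg_gt _ Wpg npgu; have := deg_gt _ Wpg' npg'u.
rewrite !piK // hgg'; nat_lia.
Qed.

End Gains.

Lemma join_singles B Z pi z u v : linking Z pi z -> joinable B Z pi z u v ->
  singles (join_ends Z pi u v) (join_mate pi u v) = singles Z pi :\: [set u; v].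
Proof.
move=> linkZ juv; have [piZ piK Zz npz] := linkZ.
have /and5P[/setD1P[nuz Zu] /setD1P[nvz Zv] nvu nvpu _] := juv.
have npuv : pi u == pi v = false by rewrite (mate_inj linkZ) // eq_sym (negbTE nvu).
apply/setP=> y; rewrite !inE /join_mate !negb_or.
case: (eqVneq y (pi v)) => [->|nypv].
  rewrite npuv andbF piK // (eq_sym v) andbC -!andbA.
  by case: (pi v == v); rewrite ?andbF.
case: (eqVneq y (pi u)) => [->|nypu]; last by rewrite !orbF -!andbA.
rewrite (eq_sym (pi v)) npuv andbF piK // (eq_sym u).
by case: (pi u == u); rewrite ?andbF.
Qed.

Lemma join_paired B Z pi z u v : linking Z pi z -> joinable B Z pi z u v ->
    singles Z pi = set0 ->
  singles (join_ends Z pi u v) (join_mate pi u v) = set0 /\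
  #|join_ends Z pi u v| + 2 = #|Z|.
Proof.
move=> linkZ juv paired.
have paired' : singles (join_ends Z pi u v) (join_mate pi u v) = set0.
  by rewrite (join_singles linkZ juv) paired set0D.
by split=> //; have := join_card linkZ juv; rewrite paired paired' cards0 !addn0.
Qed.

(** In the critical position take two couples of paths, given by edges g g' and
    k0 l, and join g to k0.  The ends g' and l become unmatched.  Breaker's next
    edge makes his graph a matching missing only one end again (otherwise he
    has wasted it or created an end of degree 2), so it meets g' or l.  If it
    meets g', then joining g' to [pi k0] removes this edge, the edge from
    [pi k0] to [pi l], and the edge between the mates [pi g'] and [pi g]. *)
Lemma join_gain_three B Z pi z k : linking Z pi z -> singles Z pi = set0 ->
    #|Z| = k.*2.+2 -> 10 <= k -> k.*2 <= pairs (cross B Z pi z) ->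
    pairs (cross B Z pi z) < k.*2.-1.*2 ->
  (exists u v, joinable B Z pi z u v /\
     pairs (cross B (join_ends Z pi u v) (join_mate pi u v) z) + 6
       <= pairs (cross B Z pi z))
  \/ (exists u v, joinable B Z pi z u v /\ forall b,
      exists u2 v2,
        joinable (b |: B) (join_ends Z pi u v) (join_mate pi u v) z u2 v2 /\
        pairs (cross (b |: B) (join_ends (join_ends Z pi u v) (join_mate pi u v) u2 v2)
           (join_mate (join_mate pi u v) u2 v2) z) + 8 <= pairs (cross B Z pi z)).
Proof.
move=> linkZ paired card_Z k_ge D_ge D_lt.
set h := cross B Z pi z in D_ge D_lt *; set D := pairs h in D_ge D_lt *.
have sym_h : symmetric h by apply: cross_sym.
have irr_h : irreflexive h by apply: cross_irr.
pose gain u v := joinable B Z pi z u v &&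
  (pairs (cross B (join_ends Z pi u v) (join_mate pi u v) z) + 6 <= D).
case: (boolP [exists u, exists v, gain u v]) => [|no_gain].
  by case/existsP=> u /existsP[v /andP[juv gain_uv]]; left; exists u, v.
right.
have {}no_gain u v : joinable B Z pi z u v ->
    D < pairs (cross B (join_ends Z pi u v) (join_mate pi u v) z) + 6.
  move=> juv; rewrite ltnNge; apply: contra no_gain => gain_uv.
  by apply/existsP; exists u; apply/existsP; exists v; rewrite /gain juv.
have deg_le1 : {in Z, forall y, deg h y <= 1}.
  move=> y _; rewrite leqNgt; apply/negP=> deg_y.
  have D_gt : 8 < D by nat_lia.
  have [u [v [juv]]] := gain_three_of_deg linkZ paired card_Z D_gt D_lt deg_y.
  by have := no_gain _ _ juv; rewrite -/h -/D; nat_lia.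
have [D_eq [excl [card_excl double]]] :=
  doubled_pieces linkZ paired card_Z D_ge deg_le1 no_gain.
rewrite -/h -/D in D_eq double.
have [piZ piK Zz npz] := linkZ.
have card_W : #|Z :\ z| = k.*2.+1 by have := cardsD1 z Z; rewrite Zz; nat_lia.
have fresh (E : {set T}) : #|E| <= 4 ->
    exists2 g, g \in Z :\ z & (g \notin excl) && (g \notin E).
  move=> card_E; have /subsetPn[g Wg] : ~~ (Z :\ z \subset excl :|: E).
    apply/negP=> /subset_leq_card; rewrite card_W.
    by move/leq_trans/(_ (leq_card_setU _ _)); nat_lia.
  by rewrite inE negb_or => nEg; exists g.
have [|g Wg /andP[ng _]] := fresh set0; first by rewrite cards0.
have [g' [hg hpg npg'z]] := double g Wg ng; rewrite -/h in hg hpg.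
have [|k0 Wk] := fresh [set g; pi g; g'; pi g'].
  apply: leq_trans (leq_card_setU _ _) _; rewrite cards1 addn1 ltnS.
  exact: card_set3.
rewrite !inE !negb_or -!andbA => /and5P[nk nkg nkpg nkg' nkpg'].
have [l [hk hpk nplz]] := double k0 Wk nk; rewrite -/h in hk hpk.
have Zg : g \in Z by case/setD1P: Wg.
have Zk : k0 \in Z by case/setD1P: Wk.
have [Wg' Wl] : g' \in Z :\ z /\ l \in Z :\ z by case/and4P: hg; case/and4P: hk.
have [Zg' Zl] : g' \in Z /\ l \in Z by case/setD1P: Wg'; case/setD1P: Wl.
have [[ngz nkz] [ng'z nlz]] : (g != z /\ k0 != z) /\ (g' != z /\ l != z).
  by case/setD1P: Wg; case/setD1P: Wk; case/setD1P: Wg'; case/setD1P: Wl.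
have [Wpg Wpk] : pi g \in Z :\ z /\ pi k0 \in Z :\ z.
  by case/and4P: hpg; case/and4P: hpk.
have inj y : y \in Z -> forall c d, h y c -> h y d -> c = d.
  by move=> Zy c d; apply: deg_le1_inj; apply: deg_le1.
have ng'g : g' != g by apply: contraTneq hg => ->; rewrite irr_h.
have ng'pg : g' != pi g by case/and4P: hg.
have nlk : l != k0 by apply: contraTneq hk => ->; rewrite irr_h.
have nlpk : l != pi k0 by case/and4P: hk.
have hkl : h l k0 by rewrite sym_h.
have nlg : l != g.
  by apply: contra nkg' => /eqP lg; rewrite (inj l Zl k0 g') // lg.
have nlpg : l != pi g.
  by apply: contra nkpg' => /eqP lpg; rewrite (inj l Zl k0 (pi g')) // lpg.
have nlg' : l != g'.
  by apply: contra nkg => /eqP lg'; rewrite (inj l Zl k0 g) // lg' sym_h.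
have nlpg' : l != pi g'.
  by apply: contra nkpg => /eqP lpg'; rewrite (inj l Zl k0 (pi g)) // lpg' sym_h.
have piE c d : c \in Z -> d \in Z -> (pi c == d) = (c == pi d).
  by move=> Zc Zd; apply/eqP/eqP=> [<-|->]; rewrite piK.
have jgk : joinable B Z pi z g k0.
  rewrite joinableE Wg Wk nkg nkpg /=; apply: contra nkg' => hgk.
  by rewrite (inj g Zg _ _ hgk hg).
exists g, k0; split=> // b.
set Z1 := join_ends Z pi g k0; set pi1 := join_mate pi g k0.
have link1 : linking Z1 pi1 z by apply: join_linking jgk.
have [paired1 card_Z1] := join_paired linkZ jgk paired.
set B1 := b |: B; set h1 := cross B1 Z1 pi1 z; set D1 := pairs h1.
have D1_le : D1 + 2 <= D.
  have := pairs_claim B Z1 pi1 z b; have := joinable_gain linkZ paired jgk.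
  have := deg_mem hg; have := deg_mem hk; rewrite -/Z1 -/pi1 -/h -/D -/B1 -/h1 -/D1; nat_lia.
have card_Z1' : #|Z1| = k.-1.*2.+2 by rewrite -/Z1 in card_Z1; nat_lia.
have D1_even : ~~ odd D1 by apply: pairs_even; [apply: cross_sym | apply: cross_irr].
(* If Breaker's edge is harmless, removing two more edges is enough. *)
have [D1_small|D1_large] := leqP D1 k.-2.*2.
  have [|u2 [v2 [j2 gain2]]] := gain_two link1 paired1 _ card_Z1' D1_small; first nat_lia.
  by exists u2, v2; split=> //; move: gain2; rewrite -/h1 -/D1; nat_lia.
have D1_eq : D1 = k.-1.*2 by nat_lia.
case: (boolP [exists u, 1 < deg h1 u]) => [/existsP[u deg_u]|].
  have [||u2 [v2 [j2 gain2]]] := gain_three_of_deg link1 paired1 card_Z1' _ _ deg_u;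
    rewrite -?/h1 -?/D1; try nat_lia.
  by exists u2, v2; split=> //; move: gain2; rewrite -/h1 -/D1; nat_lia.
rewrite negb_exists => /forallP deg1_le.
have {}deg1_le y : deg h1 y <= 1 by rewrite leqNgt.
have Z1_mem y : y \in Z -> y != g -> y != k0 -> y \in Z1.
  by move=> Zy nyg nyk; rewrite !inE negb_or nyg nyk Zy.
have npgpk : pi g == pi k0 = false by rewrite (mate_inj linkZ) // eq_sym (negbTE nkg).
have Z1pg : pi g \in Z1 by rewrite !inE eqxx /= orbT.
have Z1pk : pi k0 \in Z1 by rewrite !inE eqxx !orbT.
have Z1g' : g' \in Z1 by apply: Z1_mem; rewrite // eq_sym.
have Z1l : l \in Z1 by apply: Z1_mem.
have Z1pg' : pi g' \in Z1.
  by apply: Z1_mem; rewrite ?piZ // 1?eq_sym // eq_sym piE.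
have Z1pl : pi l \in Z1 by apply: Z1_mem; rewrite ?piZ // piE.
have pi1_pg : pi1 (pi g) = pi k0 by rewrite /pi1 /join_mate npgpk eqxx.
have pi1_pk : pi1 (pi k0) = pi g by rewrite /pi1 /join_mate eqxx.
have pi1_g' : pi1 g' = pi g'.
  by rewrite /pi1 /join_mate -piE // eq_sym (negbTE nkpg') (negbTE ng'pg).
have pi1_l : pi1 l = pi l by rewrite /pi1 /join_mate (negbTE nlpk) (negbTE nlpg).
have h1_of c d : c \in Z1 -> d \in Z1 -> d != pi1 c -> h c d -> h1 c d.
  move=> Zc Zd ndc /and4P[/setD1P[ncz _] /setD1P[ndz _] _ adj_cd].
  by rewrite /h1 /cross !in_setD1 ncz ndz Zc Zd ndc (adjS _ adj_cd) // subsetUr.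
have h1g : h1 (pi g) (pi g').
  by apply: h1_of; rewrite // pi1_pg (mate_inj linkZ) // eq_sym.
have h1k : h1 (pi k0) (pi l) by apply: h1_of; rewrite // pi1_pk (mate_inj linkZ).
have deg1_le1 : {in Z1, forall y, deg h1 y <= 1} by move=> y _.
(* Of the 2k - 1 usable ends, 2k - 2 are matched. *)
have [deg_g'|deg_l] : 0 < deg h1 g' \/ 0 < deg h1 l.
- apply/orP; rewrite -[_ || _]negbK negb_or -!eqn0Ngt; apply/negP.
  case/andP=> /eqP deg_g' /eqP deg_l.
  suff : D1 <= #|Z1 :\ z :\ g' :\ l|.
    have := cardsD1 z Z1; have := cardsD1 g' (Z1 :\ z).
    have := cardsD1 l (Z1 :\ z :\ g'); rewrite !in_setD1 nlg' nlz ng'z Z1l Z1g'.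
    have [_ _ -> _] := link1; nat_lia.
  rewrite /D1 pairs_deg card_mem_sum; apply: leq_sum => y _; rewrite !in_setD1.
  have [->|_] := eqVneq y l; first by rewrite deg_l.
  have [->|_] := eqVneq y g'; first by rewrite deg_g'.
  case: (posnP (deg h1 y)) => [->//|/deg_ends/setD1P[-> ->]]; exact: deg1_le.
- have [] := gain_three_at link1 paired1 deg1_le1 h1k deg_g'.
  + by rewrite -piE // eq_sym.
  + by rewrite pi1_pk.
  + by rewrite -piE // eq_sym.
  + by rewrite pi1_pk pi1_g'.
  by move=> j2 gain2; exists (pi k0), g'; split=> //; move: gain2;
     rewrite -/h1 -/D1; nat_lia.
have [] := gain_three_at link1 paired1 deg1_le1 h1g deg_l.
- exact: nlpg.
- by rewrite pi1_pg.
- exact: nlpg'.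
- by rewrite pi1_pg pi1_l.
by move=> j2 gain2; exists (pi g), l; split=> //; move: gain2;
   rewrite -/h1 -/D1; nat_lia.
Qed.

(** With one join left, Breaker can have blocked only one of the two ends of the
    last free path. *)
Lemma join_game_one B Z pi z : linking Z pi z -> singles Z pi = set0 ->
    #|Z| = 4 -> pairs (cross B Z pi z) <= 2 -> join_game 1 B Z pi z.
Proof.
move=> linkZ paired card_Z D_le; have [piZ piK Zz npz] := linkZ.
have [||v jxv] := @joinable_exists B Z pi z (pi z).
- by rewrite in_setD1 npz piZ.
- rewrite piK // setUAC setUid card_Z.
  have := deg_pairs (pi z) (cross_sym B linkZ) (cross_irr B Z pi z).
  by rewrite cards2; case: (_ != _) => /=; nat_lia.
exists (pi z), v; split=> // _ /=.
have linkZ' := join_linking linkZ jxv; have [piZ' _ Zz' npz'] := linkZ'.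
have [_ card_Z'] := join_paired linkZ jxv paired.
have sub2 : [set z; join_mate pi (pi z) v z] \subset join_ends Z pi (pi z) v.
  by rewrite subUset !sub1set Zz' piZ'.
suff /eqP <- : [set z; join_mate pi (pi z) v z] == join_ends Z pi (pi z) v by [].
by rewrite eqEcard sub2 cards2 eq_sym npz' /=; nat_lia.
Qed.

(** While Breaker has at least k edges, one join, or two, lower [pairs] by 4, or
    by 6, even after his replies; so the second condition persists, and k is at
    least 10 under it.  As soon as he has fewer edges, the first one holds for
    good; its maximum with 2 allows him one edge when a single join is left. *)
Lemma join_game_ends k B Z pi z : linking Z pi z -> singles Z pi = set0 ->
    #|Z| = k.*2.+2 ->
    pairs (cross B Z pi z) <= maxn k.-1.*2 2 \/
    pairs (cross B Z pi z) + 10 <= 3 * k ->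
  join_game k B Z pi z.
Proof.
elim/ltn_ind: k B Z pi => k IHk B Z pi linkZ paired card_Z D_le.
have [k0|k_gt0] := posnP k.
  rewrite k0 in card_Z *; have [piZ _ Zz npz] := linkZ.
  have sub2 : [set z; pi z] \subset Z by rewrite subUset !sub1set Zz piZ.
  rewrite /= (_ : [set z; pi z] = Z) //; apply/eqP.
  by rewrite eqEcard sub2 cards2 eq_sym npz card_Z.
have [k1|k_ge2] := leqP k 1.
  have {}k1 : k = 1 by nat_lia.
  by rewrite k1; apply: join_game_one; rewrite ?card_Z ?k1 //; nat_lia.
case def_k: k => [|k']; first by nat_lia.
have D_even : ~~ odd (pairs (cross B Z pi z)).
  by apply: pairs_even; [apply: cross_sym | apply: cross_irr].
have [D_small|D_large] := leqP (pairs (cross B Z pi z)) k.-1.*2.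
  have [u [v [juv gain_uv]]] := gain_two linkZ paired k_ge2 card_Z D_small.
  exists u, v; split=> // b; have [paired' card_Z'] := join_paired linkZ juv paired.
  have linkZ' := join_linking linkZ juv.
  by apply: IHk; rewrite -?def_k //; try nat_lia;
     have := pairs_claim B (join_ends Z pi u v) (join_mate pi u v) z b; nat_lia.
have [k_ge [D_ge D_lt]] : 10 <= k /\ k.*2 <= pairs (cross B Z pi z)
    /\ pairs (cross B Z pi z) < k.*2.-1.*2 by nat_lia.
have [] := join_gain_three linkZ paired card_Z k_ge D_ge D_lt.
  move=> [u [v [juv gain_uv]]]; exists u, v; split=> // b.
  have [paired' card_Z'] := join_paired linkZ juv paired.
  have linkZ' := join_linking linkZ juv.
  by apply: IHk; rewrite -?def_k //; try nat_lia;
     have := pairs_claim B (join_ends Z pi u v) (join_mate pi u v) z b; nat_lia.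
move=> [u [v [juv two_step]]]; exists u, v; split=> // b.
have [paired' card_Z'] := join_paired linkZ juv paired.
have linkZ' := join_linking linkZ juv.
have [u2 [v2 [juv2 gain2]]] := two_step b.
case def_k': k' => [|k'']; first by nat_lia.
exists u2, v2; split=> // b2.
have [paired2 card_Z2] := join_paired linkZ' juv2 paired'.
have linkZ2 := join_linking linkZ' juv2.
by apply: IHk; rewrite -?def_k //; try nat_lia;
   have := pairs_claim (b |: B) (join_ends (join_ends Z pi u v) (join_mate pi u v) u2 v2)
     (join_mate (join_mate pi u v) u2 v2) z b2; nat_lia.
Qed.

(** A single vertex is joined to any end.  At worst this removes none of
    Breaker's edges; the coefficient 5 pays for his reply (2) and for the join
    that is used up (3). *)
Lemma join_game_few_singles k B Z pi z : linking Z pi z ->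
    #|Z| + #|singles Z pi| = k.*2.+2 ->
    pairs (cross B Z pi z) + 5 * #|singles Z pi| + 10 <= 3 * k ->
  join_game k B Z pi z.
Proof.
elim: k B Z pi => [|k IHk] B Z pi linkZ card_Z D_le; first by nat_lia.
have [singles0|] := set_0Vmem (singles Z pi).
  apply: join_game_ends => //; move: card_Z D_le; rewrite singles0 cards0; nat_lia.
case=> a Sa; have [Za /eqP pia] : a \in Z /\ pi a == a.
  by apply/andP; rewrite inE in Sa.
have [_ _ Zz npz] := linkZ.
have naz : a != z by apply: contraNneq npz => <-; rewrite pia.
have q_gt0 : 0 < #|singles Z pi| by rewrite (cardD1 a) Sa.
have [||v jav] := @joinable_exists B Z pi z a.
- by rewrite in_setD1 naz.
- have := card_set3 z a (pi a).
  have := deg_pairs a (cross_sym B linkZ) (cross_irr B Z pi z); nat_lia.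
exists a, v; split=> // b; have linkZ' := join_linking linkZ jav.
have := pairs_claim B (join_ends Z pi a v) (join_mate pi a v) z b.
have := pairs_sub (cross_join linkZ jav); have := join_card linkZ jav.
have : #|singles (join_ends Z pi a v) (join_mate pi a v)| < #|singles Z pi|.
  apply: proper_card; apply/properP; rewrite (join_singles linkZ jav) subsetDl.
  by split=> //; exists a; rewrite // !inE eqxx.
move=> *; apply: IHk => //; nat_lia.
Qed.

(** Joining two single vertices makes a new path, which compensates for
    Breaker's next edge.  This is impossible only when the single vertices form
    a clique in Breaker's graph.  Then they are few, of the order of the square
    root of his number of edges, and the previous lemma applies. *)
Lemma join_game_many_singles C k B Z pi z : linking Z pi z ->
    #|Z| + #|singles Z pi| = k.*2.+2 ->
    pairs (cross B Z pi z) + (#|singles Z pi|).*2 <= C + k.*2 ->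
    7 * C + 120 + #|singles Z pi| <= k.*2 ->
  join_game k B Z pi z.
Proof.
elim: k B Z pi => [|k IHk] B Z pi linkZ card_Z D_le k_large; first by nat_lia.
set S := singles Z pi in card_Z D_le k_large *.
set h := cross B Z pi z in D_le *.
have [few|many] := leqP (pairs h + 5 * #|S| + 10) (3 * k.+1).
  exact: join_game_few_singles.
have [_ _ Zz npz] := linkZ.
have S_mem a : a \in S -> [/\ a \in Z :\ z & pi a = a].
  rewrite inE => /andP[Za /eqP pia]; rewrite in_setD1 Za pia; split=> //.
  by rewrite andbT; apply: contraNneq npz => <-; rewrite pia.
have [a Sa [v Sv jav]] : exists2 a, a \in S & exists2 v, v \in S & joinable B Z pi z a v.
  case: (boolP [exists a in S, exists v in S, joinable B Z pi z a v]).
    by case/exists_inP=> a Sa /exists_inP[v Sv jav]; exists a => //; exists v.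
  rewrite negb_exists_in => /forall_inP no_join.
  have clique : #|S| * #|S|.-1 <= pairs h.
    rewrite pairs_deg -sum_nat_const [X in X <= _]big_mkcond; apply: leq_sum => a _.
    case: ifP => // Sa; have -> : #|S|.-1 = #|S :\ a| by rewrite (cardsD1 a S) Sa.
    apply/subset_leq_card/subsetP=> v /setD1P[nva Sv]; rewrite inE.
    have := no_join a Sa; rewrite negb_exists_in => /forall_inP/(_ v Sv).
    have [[Wa pia] [Wv _]] := (S_mem a Sa, S_mem v Sv).
    by rewrite joinableE Wa Wv pia nva /= negbK.
  have : C + 20 < #|S| by nat_lia.
  nia.
exists a, v; split=> // b; have linkZ' := join_linking linkZ jav.
have := pairs_claim B (join_ends Z pi a v) (join_mate pi a v) z b.
have := pairs_sub (cross_join linkZ jav); have := join_card linkZ jav.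
have : #|singles (join_ends Z pi a v) (join_mate pi a v)| + 2 = #|S|.
  rewrite (join_singles linkZ jav) -(cardsID [set a; v] S) addnC; congr (_ + _).
  rewrite (_ : S :&: _ = [set a; v]) ?cards2; last first.
    by apply/setIidPr; rewrite subUset !sub1set Sa.
  by case/and5P: jav => _ _; rewrite eq_sym => ->.
rewrite -/h -/S => *; apply: IHk => //; nat_lia.
Qed.

End JoinGame.

(** * From the joining game to a Hamilton path *)

Section LinkedPaths.

Variable T : finType.
Implicit Types (M B : {set {set T}}) (Z U : {set T}) (pi : T -> T) (z : T).

Definition path_between M (a b : T) (q : seq T) : Prop :=
  exists2 s, q = a :: s & path (adj M) a s /\ last a s = b.

Lemma path_between_rev M a b q :
  path_between M a b q -> path_between M b a (rev q).
Proof.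
case=> s -> [path_s last_s]; exists (rev (belast a s)).
  by rewrite lastI last_s rev_rcons.
rewrite -last_s rev_path; split.
  by rewrite (eq_path (e' := adj M)) // => x y; rewrite adjC.
by case: s {path_s last_s} => //= x s; rewrite rev_cons last_rcons.
Qed.

Lemma path_between_cat M a b c d q r : adj M b c ->
  path_between M a b q -> path_between M c d r -> path_between M a d (q ++ r).
Proof.
move=> adj_bc [s -> [path_s last_s]] [t -> [path_t last_t]].
exists (s ++ c :: t) => //; split; last by rewrite last_cat.
by rewrite cat_path path_s last_s /= adj_bc.
Qed.

Lemma path_between_mono M M' a b q : M \subset M' ->
  path_between M a b q -> path_between M' a b q.
Proof.
move=> sMM' [s -> [path_s last_s]]; exists s => //; split=> //.
by apply: sub_path path_s => x y; apply: adjS.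
Qed.

(** The path that ends at u is [P u]; it is listed from [pi u] to u, and
    [P (pi u)] need only visit the same vertices.  Thus a join changes [P] at
    two arguments only. *)
Definition linked M U Z pi (P : T -> seq T) : Prop :=
  [/\ {in Z, forall u, path_between M (pi u) u (P u) /\ uniq (P u)},
      {in Z, forall u, P (pi u) =i P u},
      {in Z &, forall u v y, y \in P u -> y \in P v -> v = u \/ v = pi u}
    & forall y, y \in U <-> exists2 u, u \in Z & y \in P u].

Lemma linked_id M U : linked M U U id (fun y => [:: y]).
Proof.
split=> [u _||u v _ _ y|y] //; first by split=> //; exists [::].
  by rewrite !inE => /eqP-> /eqP->; left.
by split=> [Uy|[u Uu]]; [exists y; rewrite ?inE | rewrite inE => /eqP->].
Qed.

Lemma linked_join M M' U Z pi P u v :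
    {in Z, forall y, pi y \in Z} -> {in Z, forall y, pi (pi y) = y} ->
    u \in Z -> v \in Z -> v != u -> v != pi u ->
    M \subset M' -> adj M' u v -> linked M U Z pi P ->
  exists P', linked M' U (join_ends Z pi u v) (join_mate pi u v) P'.
Proof.
move=> piZ piK Zu Zv nvu nvpu sMM' adj_uv [pathP mateP disjP coverP].
pose P' y := if y == pi v then P u ++ rev (P v)
             else if y == pi u then P v ++ rev (P u) else P y.
have npuv : pi u == pi v = false.
  by apply: contra_neqF nvu => /eqP/(congr1 pi); rewrite !piK.
have P'v : P' (pi v) = P u ++ rev (P v) by rewrite /P' eqxx.
have P'u : P' (pi u) = P v ++ rev (P u) by rewrite /P' npuv eqxx.
have P'y y : y != pi u -> y != pi v -> P' y = P y.
  by rewrite /P' => /negbTE-> /negbTE->.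
have memP'v y : (y \in P' (pi v)) = (y \in P u) || (y \in P v).
  by rewrite P'v mem_cat mem_rev.
have memP'u y : (y \in P' (pi u)) = (y \in P u) || (y \in P v).
  by rewrite P'u mem_cat mem_rev orbC.
have memZ y : y \in join_ends Z pi u v ->
    [\/ y = pi u, y = pi v | [/\ y != pi u, y != pi v, y != u, y != v & y \in Z]].
  rewrite !inE negb_or -andbA.
  have [->|nypu] := eqVneq y (pi u); first by constructor 1.
  have [->|nypv] := eqVneq y (pi v); first by constructor 2.
  by rewrite /= orbF => /and3P[nyu nyv Zy]; constructor 3.
have [[path_u uniq_u] [path_v uniq_v]] := (pathP u Zu, pathP v Zv).
have disj_uv y : y \in P u -> y \in P v -> False.
  by move=> yu yv; case: (disjP u v Zu Zv y yu yv) => /eqP; apply/negP.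
have disj_new y x : y != pi u -> y != pi v -> y != u -> y != v -> y \in Z ->
    x \in P y -> (x \in P u) || (x \in P v) -> False.
  move=> nypu nypv nyu nyv Zy xy /orP[xu|xv].
    by case: (disjP u y Zu Zy x xu xy) => /eqP; apply/negP.
  by case: (disjP v y Zv Zy x xv xy) => /eqP; apply/negP.
exists P'; split.
- move=> y /memZ[->|->|[nypu nypv nyu nyv Zy]]; rewrite /join_mate ?eqxx ?npuv.
  + rewrite P'u; split.
      apply: (@path_between_cat _ _ v u); first by rewrite adjC.
        exact: path_between_mono path_v.
      by apply: path_between_rev; apply: path_between_mono path_u.
    rewrite cat_uniq uniq_v rev_uniq uniq_u andbT /=.
    by apply/hasPn=> x; rewrite mem_rev => xu; apply/negP; apply: disj_uv.
  + rewrite P'v; split.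
      apply: (@path_between_cat _ _ u v) => //.
        exact: path_between_mono path_u.
      by apply: path_between_rev; apply: path_between_mono path_v.
    rewrite cat_uniq uniq_u rev_uniq uniq_v andbT /=.
    by apply/hasPn=> x; rewrite mem_rev => xv; apply/negP=> xu; apply: disj_uv xu xv.
  rewrite (negbTE nypu) (negbTE nypv) P'y //; have [path_y uniq_y] := pathP y Zy.
  by split=> //; apply: path_between_mono path_y.
- move=> y /memZ[->|->|[nypu nypv nyu nyv Zy]] x; rewrite /join_mate ?eqxx ?npuv.
  + by rewrite memP'u memP'v.
  + by rewrite memP'u memP'v.
  rewrite (negbTE nypu) (negbTE nypv) !P'y //; first exact: mateP.
    by apply: contra nyu => /eqP/(congr1 pi); rewrite !piK // => ->.
  by apply: contra nyv => /eqP/(congr1 pi); rewrite !piK // => ->.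
- move=> y w /memZ[->|->|[nypu nypv nyu nyv Zy]]
    /memZ[->|->|[nwpu nwpv nwu nwv Zw]] x;
    rewrite /join_mate ?eqxx ?npuv ?memP'u ?memP'v; try by [left | right].
  + by rewrite P'y // => xuv xw; case: (disj_new w x).
  + by rewrite P'y // => xuv xw; case: (disj_new w x).
  + by rewrite P'y // => xy xuv; case: (disj_new y x).
  + by rewrite P'y // => xy xuv; case: (disj_new y x).
  rewrite !P'y // (negbTE nypu) (negbTE nypv); exact: disjP.
move=> y; rewrite coverP; split=> [[w Zw yw]|[w /memZ[->|->|[nwpu nwpv _ _ Zw]]]].
- have [uv|nuv] := boolP ((y \in P u) || (y \in P v)).
    by exists (pi u); rewrite ?memP'u // !inE eqxx orbT.
  have nPw t : t \in Z -> t \in [:: u; v] -> w != t /\ w != pi t.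
    move=> Zt tuv; split; apply: contraNneq nuv => wt; move: yw; rewrite wt ?mateP //;
      by move: tuv; rewrite !inE => /orP[]/eqP-> ->; rewrite ?orbT.
  have [nwu nwpu] := nPw u Zu (mem_head _ _).
  have [nwv nwpv] : w != v /\ w != pi v by apply: nPw; rewrite // !inE eqxx orbT.
  by exists w; rewrite ?P'y // !inE negb_or nwu nwv Zw.
- by rewrite memP'u => /orP[]; [exists u | exists v].
- by rewrite memP'v => /orP[]; [exists u | exists v].
- by rewrite P'y //; exists w.
Qed.

Section Transfer.

Variables (F : {set {set {set T}}}) (U : {set T}) (z : T) (M0 : {set {set T}}).
Let Bd := [set A : {set T} | #|A| == 2].

Hypothesis ham_wins : forall (M : {set {set T}}) (s : seq T), M0 \subset M ->
  path (adj M) z s -> uniq (z :: s) -> z :: s =i U ->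
  [exists A in F, A \subset M].

Lemma joinable_move B Z pi u v b : joinable (b |: B) Z pi z u v ->
  [set u; v] \in Bd :\: (b |: B).
Proof.
case/and5P=> _ _ nvu _; rewrite /adj eq_sym nvu /= => nB.
by rewrite in_setD nB inE cards2 (eq_sym u) nvu.
Qed.

Lemma join_game_wins k M B Z pi P : linking Z pi z -> linked M U Z pi P ->
    M0 \subset M -> (forall b, join_game k (b |: B) Z pi z) ->
  wins_from Bd F k M B.
Proof.
elim: k M B Z pi P => [|k IHk] M B Z pi P linkZ linkedP sM0 win.
  have /= sZ := win set0; have [piZ piK Zz npz] := linkZ.
  have [pathP mateP _ coverP] := linkedP.
  have [[s def_s [path_s last_s]] uniq_s] := pathP (pi z) (piZ z Zz).
  rewrite piK // in def_s path_s last_s.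
  apply: (ham_wins sM0 path_s); first by rewrite -def_s.
  move=> y; rewrite -def_s; apply/idP/idP=> [y_s|].
    by apply/coverP; exists (pi z); rewrite ?piZ.
  case/coverP=> u /(subsetP sZ); rewrite !inE => /orP[]/eqP-> //.
  by rewrite mateP.
apply/forall_inP=> b b_free; have [u [v [juv win']]] := win b.
apply/exists_inP; exists [set u; v]; first exact: joinable_move juv.
have linkZ' := join_linking linkZ juv.
have [piZ piK _ _] := linkZ.
have [/setD1P[_ Zu] /setD1P[_ Zv] nvu nvpu _] := and5P juv.
have adj_uv : adj ([set u; v] |: M) u v by rewrite adj_setU1 eq_sym nvu eqxx orbT.
have [P' linkedP'] :=
  linked_join piZ piK Zu Zv nvu nvpu (subsetUr [set [set u; v]] M) adj_uv linkedP.
by apply: IHk linkZ' linkedP' _ win'; apply: subset_trans sM0 (subsetUr _ _).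
Qed.

(** The first move extends the path away from z, so that the path with the
    unusable end has a second end.  The constants leave room for the two edges
    that Breaker claims before the first join. *)
Lemma path_phase_wins C M B (A : {set T}) :
    z \notin A -> U = z |: A -> M0 \subset M ->
    pairs (fun u v => [&& u \in A, v \in A & adj B u v]) <= C ->
    #|[set a in A | adj B z a]| + 1 < #|A| -> 7 * C + 149 <= #|A| ->
  wins_from Bd F #|A| M B.
Proof.
move=> nAz defU sM0 pairs_A deg_z A_large.
case def_m: #|A| => [|m]; first by lia.
apply/forall_inP=> b b_free.
have [a Aa nza] : exists2 a, a \in A & ~~ adj (b |: B) z a.
  set N := [set a in A | adj B z a] in deg_z.
  set N1 := [set a in A | [set z; a] == b].
  suff: ~~ (A \subset N :|: N1).
    case/subsetPn=> a Aa; rewrite !inE Aa /= negb_or => /andP[nB nb].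
    by exists a; rewrite // adj_setU1 negb_or nB negb_and nb orbT.
  have card_N1 : #|N1| <= 1.
    apply/card_le1_eqP=> x y; rewrite !inE => /andP[_ /eqP <-] /andP[_ /eqP/set2_eq].
    by case=> [[_ ->]|[-> ->]].
  apply: contraL deg_z => /subset_leq_card le_A; rewrite -leqNgt.
  by apply: leq_trans le_A (leq_trans (leq_card_setU _ _) _); rewrite leq_add2l.
have nza' : z != a by apply: contraNneq nAz => ->.
apply/exists_inP; exists [set z; a].
  by move: nza; rewrite /adj nza' /= !inE cards2 nza' => ->.
pose pi := join_mate id z a; pose Z := z |: A.
have Za : a \in Z by rewrite inE Aa orbT.
have Zz : z \in Z by rewrite setU11.
have adj_za : adj ([set z; a] |: M) z a by rewrite adj_setU1 nza' eqxx orbT.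
have naz : a != z by rewrite eq_sym.
have [P linkedP] := linked_join (fun y Zy => Zy) (fun y _ => erefl) Zz Za naz naz
  (subsetUr [set [set z; a]] M) adj_za (linked_id M Z).
have defZ : join_ends Z id z a = Z.
  apply/setP=> y; rewrite !inE; case: (eqVneq y a) => [->|_].
    by rewrite Aa !orbT.
  by case: (y == z); rewrite ?orbT ?orbF.
rewrite defZ -/pi in linkedP.
have piE y : pi y = if y == a then z else if y == z then a else y by [].
have linkZ : linking Z pi z.
  split=> [y Zy|y Zy||] //; rewrite !piE.
  - by case: ifP => // _; case: ifP.
  - case: (eqVneq y a) => [->|nya]; first by rewrite (negbTE nza') eqxx.
    case: (eqVneq y z) => [->|nyz]; first by rewrite eqxx.
    by rewrite (negbTE nya) (negbTE nyz).
  by rewrite (negbTE nza') eqxx.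
have singlesZ : singles Z pi = A :\ a.
  apply/setP=> y; rewrite !inE piE.
  case: (eqVneq y a) => [->|nya]; first by rewrite (negbTE nza') andbF.
  case: (eqVneq y z) => [->|nyz]; last by rewrite eqxx andbT.
  by rewrite (negbTE naz) (negbTE nAz).
have card_Aa : #|A :\ a| = m by have := cardsD1 a A; rewrite Aa def_m; case.
have card_Z : #|Z| = m.+2 by rewrite cardsU1 nAz def_m.
have {}linkedP : linked ([set z; a] |: M) U Z pi P by rewrite defU.
apply: (@join_game_wins m _ _ Z pi P linkZ linkedP).
  exact: subset_trans sM0 (subsetUr _ _).
move=> b'; apply: (@join_game_many_singles T (C + 4)) => //.
- by rewrite singlesZ card_Aa card_Z; nat_lia.
- rewrite singlesZ card_Aa.
  have le0 : pairs (cross B Z pi z) <= C.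
    apply: leq_trans pairs_A; apply: pairs_sub => x y /and4P[].
    by rewrite !inE => /andP[/negbTE-> /= ->] /andP[/negbTE-> /= ->] _ ->.
  rewrite leq_add2r; apply: leq_trans (pairs_claim _ _ _ _ _) _.
  rewrite (addnA C 2 2) leq_add2r; apply: leq_trans (pairs_claim _ _ _ _ _) _.
  by rewrite leq_add2r.
by rewrite singlesZ card_Aa; nat_lia.
Qed.

End Transfer.

End LinkedPaths.

(** * Embedding the rest of the tree *)

Section PartialEmbedding.

Variables (V T : finType) (e : rel V) (Delta : nat).
Hypotheses (sym_e : symmetric e) (irr_e : irreflexive e).
Hypothesis deg_e : forall v, degree e v <= Delta.

Implicit Types (S : {set V}) (f : V -> T) (B : {set {set T}}).

Definition avail S f : {set T} := ~: [set f x | x in S].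

Definition missing S (u : V) : nat := #|[set w | e u w & w \notin S]|.

Definition blocked S f B (u : V) : nat := #|[set a in avail S f | adj B (f u) a]|.

(** The threshold for Breaker's edges at u is one more than the number of
    neighbours of u already embedded (at least, as deg u <= Delta), so it rises
    each time u is extended: using an overloaded vertex always helps. *)
Definition excess S f B (u : V) : nat :=
  if missing S u == 0 then 0 else (blocked S f B u + missing S u) - Delta.+1.

Definition avail_rel S f B : rel T := fun a b =>
  [&& a \in avail S f, b \in avail S f & adj B a b].

Definition danger S f B : nat :=
  pairs (avail_rel S f B) + (\sum_(u in S) excess S f B u).*2.

Definition extend f v a : V -> T := fun x => if x == v then a else f x.

Lemma avail_rel_sym S f B : symmetric (avail_rel S f B).
Proof. by move=> a b; rewrite /avail_rel adjC andbCA. Qed.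

Lemma avail_rel_irr S f B : irreflexive (avail_rel S f B).
Proof. by move=> a; rewrite /avail_rel adj_irr !andbF. Qed.

Lemma avail_mem S f a x : a \in avail S f -> x \in S -> f x != a.
Proof. by rewrite inE => nSa Sx; apply: contraNneq nSa => <-; apply: imset_f. Qed.

Lemma excess_le S f B B' u d :
  blocked S f B' u <= blocked S f B u + d -> excess S f B' u <= excess S f B u + d.
Proof. by rewrite /excess; case: ifP => //; nat_lia. Qed.

(** An edge between two available vertices counts twice among the pairs, and an
    edge from an embedded to an available vertex raises a single excess by at
    most one; the same edge cannot do both. *)
Lemma danger_claim S f B b : {in S &, injective f} ->
  danger S f (b |: B) <= danger S f B + 2.
Proof.
move=> inj_f; rewrite /danger.
pose new u a := [&& u \in S, a \in avail S f & [set f u; a] == b].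
have le_blocked u : u \in S ->
    blocked S f (b |: B) u <= blocked S f B u + #|[set a | new u a]|.
  move=> Su; apply: leq_trans (leq_card_setU _ _).
  apply/subset_leq_card/subsetP=> a; rewrite !inE adj_setU1.
  rewrite /new Su inE /=.
  by case/andP=> -> /orP[->|/andP[_ ->]] //; rewrite orbT.
have le_excess : \sum_(u in S) excess S f (b |: B) u
    <= \sum_(u in S) excess S f B u + #|[set p : V * T | new p.1 p.2]|.
  have -> : #|[set p : V * T | new p.1 p.2]| = \sum_(u in S) #|[set a | new u a]|.
    rewrite card_sum_bool -(pair_bigA addn (fun u a => nat_of_bool (new u a))) /=.
    rewrite [RHS]big_mkcond; apply: eq_bigr => u _; rewrite card_sum_bool.
    case: ifP => // nSu; rewrite big1 // => a _; by rewrite /new nSu.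
  by rewrite -big_split; apply: leq_sum => u Su; apply: excess_le; apply: le_blocked.
have card_new : #|[set p : V * T | new p.1 p.2]| <= 1.
  apply/card_le1_eqP=> [[u a] [u' a']]; rewrite !inE /new /= => /and3P[Su Aa /eqP <-].
  case/and3P=> Su' Aa' /eqP/set2_eq[[fu ->]|[fu _]].
    by rewrite (inj_f _ _ Su' Su fu).
  by have := avail_mem Aa Su'; rewrite fu eqxx.
case: (pickP [pred p : T * T | avail_rel S f (b |: B) p.1 p.2
                    && ~~ avail_rel S f B p.1 p.2]) => [[c d]|no_new].
  case/andP=> /and3P[/= Ac Ad adj_cd] new_cd.
  have def_b : [set c; d] = b.
    move: adj_cd; rewrite adj_setU1 => /orP[adj_cd|/andP[_ /eqP//]].
    by rewrite /avail_rel Ac Ad adj_cd in new_cd.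
  have no_new : #|[set p : V * T | new p.1 p.2]| = 0.
    apply/eqP; rewrite cards_eq0; apply/eqP/setP=> [[u a]]; rewrite !inE /new /=.
    apply/negbTE/negP=> /and3P[Su _ /eqP]; rewrite -def_b => /set2_eq[[fu _]|[fu _]].
      by have := avail_mem Ac Su; rewrite fu eqxx.
    by have := avail_mem Ad Su; rewrite fu eqxx.
  rewrite no_new addn0 in le_excess; rewrite addnAC leq_add ?leq_double //.
  apply: (@pairs_add_edge _ _ _ b) => c' d' /and3P[Ac' Ad']; rewrite adj_setU1.
  by rewrite /avail_rel Ac' Ad' => /orP[->//|/andP[_ ->]]; rewrite orbT.
rewrite -addnA leq_add //.
  by apply: pairs_sub => c d h_cd; have /= := no_new (c, d); rewrite h_cd => /negbFE.
rewrite -(doubleD _ 1) leq_double; apply: leq_trans le_excess _.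
by rewrite leq_add2l.
Qed.

Section OneExtension.

Variables (S : {set V}) (f : V -> T) (B : {set {set T}}) (u v : V) (a : T).
Hypotheses (Su : u \in S) (nSv : v \notin S) (e_uv : e u v).
Hypothesis Aa : a \in avail S f.

Local Notation S' := (v |: S).
Local Notation f' := (extend f v a).

Lemma extend_old w : w \in S -> f' w = f w.
Proof. by rewrite /extend => Sw; case: eqP nSv => // <-; rewrite Sw. Qed.

Lemma extend_new : f' v = a.
Proof. by rewrite /extend eqxx. Qed.

Lemma avail_extend : avail S' f' = avail S f :\ a.
Proof.
apply/setP=> b; rewrite !inE imsetU1 extend_new in_setU1 negb_or; congr (_ && ~~ _).
by rewrite (@eq_in_imset _ _ f' f) // => w; apply: extend_old.
Qed.

Lemma missing_extend w : missing S' w <= missing S w.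
Proof.
apply/subset_leq_card/subsetP=> x; rewrite !inE negb_or.
by case/andP=> -> /andP[_ ->].
Qed.

Lemma missing_extend_parent : missing S' u < missing S u.
Proof.
apply: proper_card; apply/properP; split.
  by apply/subsetP=> x; rewrite !inE negb_or => /andP[-> /andP[_ ->]].
by exists v; rewrite !inE ?e_uv ?nSv ?eqxx ?andbF.
Qed.

Lemma missing_extend_new : missing S' v < Delta.
Proof.
apply: leq_trans (deg_e v); apply: proper_card; apply/properP; split.
  by apply/subsetP=> x; rewrite !inE => /andP[].
by exists u; rewrite !inE sym_e e_uv // Su orbT.
Qed.

Lemma blocked_extend w : w \in S -> blocked S' f' B w <= blocked S f B w.
Proof.
move=> Sw; rewrite /blocked extend_old // avail_extend.
by apply/subset_leq_card/subsetP=> b; rewrite !inE => /andP[/andP[_ ->]].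
Qed.

Lemma blocked_extend_lt w : w \in S -> adj B (f w) a ->
  blocked S' f' B w < blocked S f B w.
Proof.
move=> Sw adj_wa; rewrite /blocked extend_old // avail_extend.
apply: proper_card; apply/properP; split.
  by apply/subsetP=> b; rewrite !inE => /andP[/andP[_ ->]].
by exists a; rewrite inE ?Aa // !inE eqxx.
Qed.

Lemma excess_extend w : w \in S -> excess S' f' B w <= excess S f B w.
Proof.
move=> Sw; have := blocked_extend Sw; have := missing_extend w; rewrite /excess.
by case: ifP => [/eqP|]; case: ifP => [/eqP|]; nat_lia.
Qed.

Lemma excess_extend_lt w : w \in S -> 0 < excess S f B w ->
  adj B (f w) a \/ w = u -> excess S' f' B w < excess S f B w.
Proof.
move=> Sw; have := blocked_extend Sw; have := missing_extend w; rewrite /excess.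
move=> le_m le_b ex_w gain.
have : blocked S' f' B w + missing S' w < blocked S f B w + missing S w.
  case: gain => [/(blocked_extend_lt Sw)|wu]; first by nat_lia.
  by move: missing_extend_parent; rewrite -wu; nat_lia.
by move: ex_w; case: ifP => [/eqP|]; case: ifP => [/eqP|]; nat_lia.
Qed.

Lemma excess_extend_new :
  excess S' f' B v <= (deg (avail_rel S f B) a).-1.
Proof.
have : blocked S' f' B v <= deg (avail_rel S f B) a.
  rewrite /blocked extend_new avail_extend; apply/subset_leq_card/subsetP=> b.
  by rewrite /avail_rel inE in_setD1 [in X in _ -> X]inE Aa => /andP[/andP[_ ->] ->].
by have := missing_extend_new; rewrite /excess; case: ifP => // _; nat_lia.
Qed.

(** The Breaker edges between a and available vertices may turn into excess of
    v; but since v has at most Delta - 1 missing neighbours, this excess is 0 or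
    at least two below their number.  Hence embedding at an a with such edges
    gains. *)
Lemma danger_extend w : w \in S ->
  danger S' f' B + (0 < deg (avail_rel S f B) a).*2
    + (excess S f B w - excess S' f' B w).*2 <= danger S f B.
Proof.
move=> Sw.
have removed : pairs (avail_rel S' f' B) + (deg (avail_rel S f B) a).*2
    <= pairs (avail_rel S f B).
  apply: pairs_remove; rewrite /avail_rel; first exact: avail_rel_sym.
  - exact: avail_rel_irr.
  - by move=> c d /and3P[]; rewrite avail_extend !in_setD1 => /andP[_ ->] /andP[_ ->] ->.
  - by move=> c; rewrite avail_extend !in_setD1 eqxx.
  - by move=> c; rewrite avail_extend !in_setD1 eqxx andbF.
have sums : \sum_(x in S) excess S' f' B x + (excess S f B w - excess S' f' B w)
    <= \sum_(x in S) excess S f B x.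
  rewrite (bigD1 w) //= [X in _ <= X](bigD1 w) //= addnAC subnKC ?excess_extend //.
  by rewrite leq_add2l; apply: leq_sum => x /andP[Sx _]; apply: excess_extend.
rewrite /danger big_setU1 //=; have := excess_extend_new.
move: removed sums; case: (deg _ _) => [|d] /=; nat_lia.
Qed.

End OneExtension.

Section Strategy.

Variables (Q : {set V}) (p : V).
Hypothesis Q_attach : forall w x, w \notin Q -> x \in Q -> e w x -> w = p.
Hypothesis Q_attach_once : #|[set x in Q | e p x]| <= 1.

Definition usable S u v := [&& u \in S, v \notin S, v \notin Q & e u v].

Definition conn_in S :=
  {in S &, forall x y, connect [rel a b | [&& a \in S, b \in S & e a b]] x y}.

Lemma conn_in_extend S u v :
  conn_in S -> u \in S -> e u v -> conn_in (v |: S).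
Proof.
move=> conn_S Su e_uv.
set r' := [rel a b | [&& a \in v |: S, b \in v |: S & e a b]].
have sub_r : subrel [rel a b | [&& a \in S, b \in S & e a b]] (connect r').
  move=> a b /= /and3P[Sa Sb e_ab]; apply: connect1.
  by rewrite /= !in_setU1 Sa Sb e_ab !orbT.
have old x y : x \in S -> y \in S -> connect r' x y.
  by move=> Sx Sy; apply: connect_sub sub_r _ _ (conn_S x y Sx Sy).
have uv : connect r' u v by apply: connect1; rewrite /= !in_setU1 Su eqxx e_uv orbT.
have vu : connect r' v u.
  by apply: connect1; rewrite /= !in_setU1 Su eqxx sym_e e_uv orbT.
move=> x y; rewrite !in_setU1 => /orP[/eqP->|Sx] /orP[/eqP->|Sy] //.
- exact: connect_trans vu (old u y Su Sy).
- exact: connect_trans (old x u Sx Su) uv.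
exact: old.
Qed.

(** Two neighbours in a connected part would close a cycle through v; hence
    embedding v requires one new edge only. *)
Lemma conn_in_only S u v : acyclic e -> conn_in S -> v \notin S -> u \in S ->
  e u v -> {in S, forall w, e w v -> w = u}.
Proof.
move=> acyc conn_S nSv Su e_uv w Sw e_wv; apply/eqP/negPn/negP=> nwu.
have /connectP[s0 path_s0 last_s0] := conn_S u w Su Sw.
case/shortenP: path_s0 last_s0 => s path_s uniq_s _ def_w.
have S_s : {subset u :: s <= S}.
  elim: s u Su path_s {uniq_s def_w e_uv nwu} => [|y s IHs] x Sx /=.
    by move=> _ c; rewrite inE => /eqP->.
  case/andP=> /and3P[_ Sy _] path_s c; rewrite inE => /orP[/eqP->//|].
  exact: IHs Sy path_s c.
have s_neq0 : 0 < size s by case: s def_w {path_s uniq_s S_s} nwu => //= ->; rewrite eqxx.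
apply: (acyc (v :: u :: s)) => //.
apply/andP; split; last first.
  by rewrite cons_uniq uniq_s andbT; apply: contra nSv => /S_s.
rewrite /cycle rcons_cons /= sym_e e_uv rcons_path -def_w e_wv andbT.
by apply: sub_path path_s => x y /and3P[].
Qed.

(** Q hangs off p, so S together with Q would be closed under adjacency if no
    extension of S outside Q existed. *)
Lemma usable_exists S : connected e -> p \in S -> S \subset ~: Q ->
  S != ~: Q -> exists u v, usable S u v.
Proof.
move=> conn_e Sp sSQ neqSQ.
case: (boolP [exists u, exists v, usable S u v]) => [|no_usable].
  by case/existsP=> u /existsP[v uv]; exists u, v.
case/negP: neqSQ; rewrite eqEsubset sSQ; apply/subsetP=> w; rewrite inE => nQw.
have closed_SQ : closed e (S :|: Q).
  apply: intro_closed => [|x y e_xy]; first exact: sym_connect_sym.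
  rewrite !in_setU => /orP[Sx|Qx].
    apply: contraR no_usable; rewrite negb_or => /andP[nSy nQy].
    by apply/existsP; exists x; apply/existsP; exists y; rewrite /usable Sx nSy nQy.
  have [Qy|nQy] := boolP (y \in Q); first by apply/orP; right.
  by apply/orP; left; rewrite (Q_attach nQy Qx) // sym_e.
have := closed_connect closed_SQ (conn_e p w).
by rewrite !in_setU Sp (negbTE nQw) orbF.
Qed.

Lemma blocked_le_danger S f B u : u \in S -> 0 < missing S u ->
  (blocked S f B u).*2 <= danger S f B + Delta.*2.
Proof.
move=> Su miss_u.
have : excess S f B u <= \sum_(x in S) excess S f B x.
  by rewrite (bigD1 u) //= leq_addr.
rewrite /danger /excess; case: ifP => [/eqP|_]; nat_lia.
Qed.

Lemma usable_missing S u v : usable S u v -> 0 < missing S u.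
Proof.
case/and4P=> _ nSv _ e_uv; apply/card_gt0P; exists v.
by rewrite inE e_uv.
Qed.

Lemma avail_unblocked S f B u :
  blocked S f B u < #|avail S f| -> exists2 a, a \in avail S f & ~~ adj B (f u) a.
Proof.
move=> lt_u; suff: ~~ (avail S f \subset [set a in avail S f | adj B (f u) a]).
  by case/subsetPn=> a Aa; rewrite inE Aa; exists a.
by apply: contraL lt_u => /subset_leq_card; rewrite -leqNgt.
Qed.

(** Call an available vertex useful if embedding it gains, and suppose that no
    move gains.  Then all useful vertices are Breaker neighbours of u0, which
    has no excess and hence at most Delta of them.  So at most Delta^2 ordered
    pairs of available vertices are Breaker edges.  The only vertex outside Q
    whose missing neighbours all lie in Q is p, which has one such neighbour,
    and all available Breaker neighbours of a vertex of positive excess are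
    useful; so no excess is positive. *)
Lemma safe_move S f B u0 v0 : S \subset ~: Q -> usable S u0 v0 ->
    danger S f B + Delta.*2 < #|avail S f|.*2 ->
  exists u v a, [/\ usable S u v, a \in avail S f, ~~ adj B (f u) a
    & danger (v |: S) (extend f v a) B <= maxn (Delta ^ 2) (danger S f B - 2)].
Proof.
move=> sSQ use0 A_large.
have gain u v a w : usable S u v -> a \in avail S f -> w \in S ->
    danger (v |: S) (extend f v a) B + (0 < deg (avail_rel S f B) a).*2
    + (excess S f B w - excess (v |: S) (extend f v a) B w).*2 <= danger S f B.
  move=> use_uv Aa Sw; have /and4P[Su nSv _ e_uv] := use_uv.
  exact: (danger_extend _ Su nSv e_uv Aa Sw).
have unblocked u v : usable S u v -> exists2 a, a \in avail S f & ~~ adj B (f u) a.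
  move=> use_uv; apply: avail_unblocked; have /and4P[Su _ _ _] := use_uv.
  have := blocked_le_danger f B Su (usable_missing use_uv); nat_lia.
have [small|large] := leqP (danger S f B) (Delta ^ 2).
  have [a Aa nadj] := unblocked _ _ use0; exists u0, v0, a; split=> //.
  have /and4P[Su0 _ _ _] := use0; have := gain _ _ _ _ use0 Aa Su0; nat_lia.
case: (boolP [exists u, exists v, usable S u v && (0 < excess S f B u)]).
  case/existsP=> u /existsP[v /andP[use_uv ex_u]].
  have [a Aa nadj] := unblocked _ _ use_uv; exists u, v, a; split=> //.
  have /and4P[Su nSv _ e_uv] := use_uv; have := gain _ _ _ _ use_uv Aa Su.
  have := excess_extend_lt nSv e_uv Aa Su ex_u (or_intror erefl); nat_lia.
rewrite negb_exists => /forallP no_excess.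
have {}no_excess u v : usable S u v -> excess S f B u = 0.
  move=> use_uv; have := no_excess u; rewrite negb_exists => /forallP/(_ v).
  by rewrite use_uv /= -eqn0Ngt => /eqP.
pose useful a := (a \in avail S f) && ((0 < deg (avail_rel S f B) a)
   || [exists w in S, (0 < excess S f B w) && adj B (f w) a]).
case: (boolP [exists u, exists v, exists a,
    [&& usable S u v, useful a & ~~ adj B (f u) a]]).
  case/existsP=> u /existsP[v /existsP[a /and3P[use_uv /andP[Aa use_a] nadj]]].
  exists u, v, a; split=> //; have /and4P[Su nSv _ e_uv] := use_uv.
  case/orP: use_a => [deg_a|/exists_inP[w Sw /andP[ex_w adj_wa]]].
    by have := gain _ _ _ _ use_uv Aa Su; rewrite deg_a; nat_lia.
  have := gain _ _ _ _ use_uv Aa Sw.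
  have := excess_extend_lt nSv e_uv Aa Sw ex_w (or_introl adj_wa); nat_lia.
move=> no_good; pose N := [set a in avail S f | adj B (f u0) a].
have useful_N a : useful a -> a \in N.
  move=> use_a; rewrite inE; have /andP[-> _] := use_a; apply: contraR no_good => nadj.
  by apply/existsP; exists u0; apply/existsP; exists v0; apply/existsP; exists a;
     rewrite use0 use_a.
have card_N : #|N| <= Delta.
  have := no_excess _ _ use0; have := usable_missing use0; rewrite /excess -/N.
  by rewrite /blocked -/N; case: ifP => [/eqP|_]; nat_lia.
have pairs_le : pairs (avail_rel S f B) <= Delta ^ 2.
  apply: (@leq_trans #|setX N N|); last by rewrite cardsX -mulnn leq_mul.
  apply/subset_leq_card/subsetP=> [[a b]]; rewrite inE in_setX /= => h_ab.
  have /and3P[Aa Ab _] := h_ab; apply/andP; split; apply: useful_N; apply/andP.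
    by split=> //; rewrite deg_gt0; apply/orP; left; apply/existsP; exists b.
  split=> //; rewrite deg_gt0; apply/orP; left; apply/existsP; exists a.
  by rewrite avail_rel_sym.
have excess0 w : w \in S -> excess S f B w = 0.
  move=> Sw; apply/eqP; rewrite eqn0Ngt; apply/negP=> ex_w.
  have nQw : w \notin Q by have := subsetP sSQ w Sw; rewrite inE.
  have missQ x : e w x -> x \notin S -> x \in Q.
    move=> e_wx nSx; apply/negPn/negP=> nQx; have := no_excess w x.
    by rewrite /usable Sw nSx nQx e_wx => /(_ isT) ex0; rewrite ex0 in ex_w.
  have miss_le : missing S w <= 1.
    apply: leq_trans Q_attach_once; apply/subset_leq_card/subsetP=> x.
    rewrite !inE => /andP[e_wx nSx]; have Qx := missQ x e_wx nSx.
    by rewrite Qx -(Q_attach nQw Qx e_wx).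
  have block_le : blocked S f B w <= Delta.
    apply: leq_trans card_N; apply/subset_leq_card/subsetP=> a.
    rewrite inE => /andP[Aa adj_wa]; apply: useful_N; rewrite /useful Aa /=.
    by apply/orP; right; apply/exists_inP; exists w; rewrite // ex_w.
  by move: ex_w; rewrite /excess; case: ifP => // _; nat_lia.
by move: large; rewrite /danger big1 // addn0 ltnNge pairs_le.
Qed.

Definition embeds S f (M : {set {set T}}) : Prop :=
  {in S &, forall x y, e x y -> [set f x; f y] \in M}.

Lemma embeds_mono S f (M M' : {set {set T}}) : M \subset M' -> embeds S f M -> embeds S f M'.
Proof.
by move=> /subsetP sMM' emb x y Sx Sy e_xy; apply: sMM'; apply: emb.
Qed.

Lemma embeds_extend S f M u v a : v \notin S -> {in S, forall w, e w v -> w = u} ->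
  embeds S f M -> embeds (v |: S) (extend f v a) ([set f u; a] |: M).
Proof.
move=> nSv only_u emb.
have new y : y \in S -> e y v -> [set extend f v a y; extend f v a v] = [set f u; a].
  by move=> Sy e_yv; rewrite extend_new (@extend_old S f v a nSv) // (only_u y Sy e_yv).
move=> x y; rewrite !in_setU1 => /orP[/eqP->|Sx] /orP[/eqP->|Sy] e_xy.
- by rewrite irr_e in e_xy.
- by rewrite setUC new ?eqxx // sym_e.
- by rewrite new ?eqxx.
by rewrite !(@extend_old S f v a nSv) // emb ?orbT.
Qed.

Lemma inj_extend S f v a : v \notin S -> a \in avail S f ->
  {in S &, injective f} -> {in v |: S &, injective (extend f v a)}.
Proof.
move=> nSv Aa inj_f x y; rewrite !in_setU1 => /orP[/eqP->|Sx] /orP[/eqP->|Sy] //.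
- by rewrite extend_new (@extend_old S f v a nSv) // => fy; have := avail_mem Aa Sy; rewrite -fy eqxx.
- by rewrite extend_new (@extend_old S f v a nSv) // => fx; have := avail_mem Aa Sx; rewrite fx eqxx.
by rewrite !(@extend_old S f v a nSv) //; apply: inj_f.
Qed.

Lemma card_avail S f : {in S &, injective f} -> #|avail S f| + #|S| = #|T|.
Proof. by move=> inj_f; rewrite -(card_in_imset inj_f) addnC cardsC. Qed.

Lemma tree_phase_wins (F : {set {set {set T}}}) k S f M B :
    acyclic e -> connected e -> p \notin Q -> 0 < #|[set x in Q | e p x]| ->
    #|V| = #|T| -> 7 * Delta ^ 2 + Delta + 149 <= #|Q| ->
    (forall f' M' s, {in ~: Q &, injective f'} -> embeds (~: Q) f' M' ->
       path (adj M') (f' p) s -> uniq (f' p :: s) ->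
       f' p :: s =i f' p |: avail (~: Q) f' -> [exists A in F, A \subset M']) ->
    p \in S -> S \subset ~: Q -> conn_in S -> {in S &, injective f} ->
    embeds S f M -> danger S f B <= Delta ^ 2 -> #|~: Q| = #|S| + k ->
  wins_from [set A : {set T} | #|A| == 2] F (k + #|Q|) M B.
Proof.
move=> acyc conn_e nQp Q_next card_VT Q_large final.
elim: k S f M B => [|k IHk] S f M B Sp sSQ conn_S inj_f emb danger_le card_S.
  have defS : S = ~: Q by apply/eqP; rewrite eqEcard sSQ card_S addn0 /=.
  have card_A : #|avail S f| = #|Q|.
    by have := card_avail inj_f; have := cardsC Q; rewrite -defS; nat_lia.
  have miss_p : 0 < missing S p.
    have [x] := card_gt0P Q_next; rewrite inE => /andP[Qx e_px].
    by apply/card_gt0P; exists x; rewrite inE e_px defS inE Qx.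
  rewrite add0n -card_A.
  apply: (@path_phase_wins T F (f p |: avail S f) (f p) M _ (Delta ^ 2)) => //.
  - move=> M' s sMM' path_s uniq_s s_all; rewrite defS in inj_f emb s_all.
    by apply: (final f M' s) => //; apply: embeds_mono emb.
  - by rewrite inE negbK; apply: imset_f.
  - by move: danger_le; rewrite /danger; apply: leq_trans; apply: leq_addr.
  - have := blocked_le_danger f B Sp miss_p; rewrite card_A /blocked.
    by move: danger_le Q_large; move: (danger _ _ _) (Delta ^ 2); nat_lia.
  by rewrite card_A; nat_lia.
have neqSQ : S != ~: Q.
  by apply/eqP=> defS; move: card_S; rewrite -defS; nat_lia.
have [u0 [v0 use0]] := usable_exists conn_e Sp sSQ neqSQ.
apply/forall_inP=> b _; set B1 := b |: B.
have danger1 : danger S f B1 <= Delta ^ 2 + 2.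
  by apply: leq_trans (danger_claim _ _ inj_f) _; rewrite leq_add2r.
have A_large : danger S f B1 + Delta.*2 < #|avail S f|.*2.
  have := card_avail inj_f; have := cardsC Q.
  by move: danger1 Q_large; move: (danger _ _ _) (Delta ^ 2); nat_lia.
have [u [v [a [use_uv Aa nadj danger2]]]] := safe_move sSQ use0 A_large.
have /and4P[Su nSv nQv e_uv] := use_uv.
have only_u := conn_in_only acyc conn_S nSv Su e_uv.
have nfua : f u != a := avail_mem Aa Su.
apply/exists_inP; exists [set f u; a].
  by move: nadj; rewrite /adj nfua /= in_setD inE cards2 nfua => ->.
apply: (IHk (v |: S) (extend f v a)).
- by rewrite in_setU1 Sp orbT.
- by rewrite subUset sub1set inE nQv.
- exact: conn_in_extend e_uv.
- exact: inj_extend.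
- exact: embeds_extend.
- by apply: leq_trans danger2 _; rewrite geq_max leqnn; nat_lia.
by rewrite cardsU1 nSv card_S; nat_lia.
Qed.

End Strategy.

End PartialEmbedding.

(** * The pendant path and the end of the proof *)

Section PendantPath.

Variables (V : finType) (e : rel V).
Hypothesis sym_e : symmetric e.

Lemma bare_path_rev x s : 0 < size s -> bare_path e x s ->
  exists s', [/\ bare_path e (last x s) s', size s' = size s & last (last x s) s' = x].
Proof.
case: s => [//|y s] _ [path_s uniq_s deg2].
exists (rcons (rev (belast y s)) x).
have def_rev : last y s :: rcons (rev (belast y s)) x = rev (x :: y :: s).
  by rewrite rev_cons (lastI y) rev_rcons.
split; first split.
- rewrite (_ : rcons _ x = rev (belast x (y :: s))) ?rev_path; last first.
    by rewrite /= rev_cons.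
  by rewrite (eq_path (e' := e)) // => v w; rewrite sym_e.
- by rewrite def_rev rev_uniq.
- by move=> v; rewrite belast_rcons /= mem_rev; apply: deg2.
- by rewrite size_rcons size_rev size_belast.
by rewrite last_rcons.
Qed.

Variables (p : V) (t : seq V).
Hypotheses (bare_t : bare_path e p t) (leaf_t : leaf e (last p t)).

Local Notation vs := (p :: t).

Lemma deg2_neighbors x y z w : degree e x = 2 -> e x y -> e x z -> y != z ->
  e x w -> w = y \/ w = z.
Proof.
move=> deg_x exy exz nyz exw.
have : [set y; z] == [set w | e x w].
  rewrite eqEcard; apply/andP; split; last by rewrite cards2 nyz [X in X <= _]deg_x.
  by rewrite subUset !sub1set !inE exy.
move/eqP=> defN; have : w \in [set y; z] by rewrite defN inE.
by rewrite !inE => /orP[]/eqP; [left | right].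
Qed.

(** Every tree edge that meets the inner part of the pendant path is one of its
    own edges, because the degrees there leave no room for others. *)
Lemma pendant_edge x y : x \in t -> e x y -> exists2 i, i < size t &
  (x = nth p vs i /\ y = nth p vs i.+1) \/ (x = nth p vs i.+1 /\ y = nth p vs i).
Proof.
have [path_t uniq_t _] := bare_t => tx exy.
have e_nth i : i < size t -> e (nth p vs i) (nth p vs i.+1).
  by move=> lt_i; apply: (pathP p path_t).
pose j := index x t; have lt_j : j < size t by rewrite index_mem.
have def_x : x = nth p vs j.+1 by rewrite /= nth_index.
have e_prev : e x (nth p vs j) by rewrite sym_e {1}def_x; apply: e_nth.
have [last_j|nlast_j] := eqVneq j.+1 (size t).
  have leaf_x : degree e x = 1.
    by rewrite def_x last_j /= -[RHS]leaf_t; congr degree; rewrite (last_nth p).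
  exists j => //; right; split=> //.
  have /card_le1_eqP : #|[set w | e x w]| <= 1 by rewrite -[#|_|]/(degree e x) leaf_x.
  by apply; rewrite inE.
have lt_j1 : j.+1 < size t by rewrite ltn_neqAle nlast_j.
have e_next : e x (nth p vs j.+2) by rewrite def_x; apply: e_nth.
have deg_x : degree e x = 2.
  have := tx; case def_t: t lt_j1 => [//|y' t'] lt_j1.
  have [_ _ deg2] := bare_t; rewrite def_t /= in deg2.
  rewrite lastI mem_rcons inE => /orP[/eqP last_x|]; last exact: deg2.
  case/eqP: nlast_j; apply/eqP; rewrite -(nth_uniq p _ _ uniq_t) //.
  by rewrite -def_x last_x -(last_nth p) def_t.
have neq : nth p vs j != nth p vs j.+2.
  by rewrite nth_uniq //= ?ltnS 1?ltnW //; lia.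
case: (deg2_neighbors deg_x e_prev e_next neq exy) => ->.
  by exists j => //; right.
by exists j.+1 => //; left.
Qed.

Lemma pendant_attach w x : w \notin t -> x \in t -> e w x -> w = p.
Proof.
move=> ntw tx; rewrite sym_e => /(pendant_edge tx)[i lt_i [[_ def_w]|[_ def_w]]].
  by case/negP: ntw; rewrite def_w /= mem_nth.
case: i lt_i def_w => [//|i] lt_i def_w.
by case/negP: ntw; rewrite def_w /= mem_nth // ltnW.
Qed.

Lemma pendant_next x : x \in t -> e p x -> x = nth p vs 1.
Proof.
have [_ uniq_t _] := bare_t => tx; rewrite sym_e => /(pendant_edge tx)[i lt_i].
case=> [[_ def_p]|[def_x def_p]].
  have : (0 == i.+1) by rewrite -(nth_uniq p _ _ uniq_t) // -def_p.
  by [].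
suff i0 : i = 0 by rewrite def_x i0.
by apply/esym/eqP; rewrite -(nth_uniq p _ _ uniq_t) //= -?def_p // ltnS ltnW.
Qed.

Lemma complete_embedding n (f : V -> 'I_n) M (s : seq 'I_n) :
    let Q := [set x in t] in
    {in ~: Q &, injective f} -> embeds e (~: Q) f M -> path (adj M) (f p) s ->
    uniq (f p :: s) -> f p :: s =i f p |: avail (~: Q) f -> size s = size t ->
  [exists A in copies e n, A \subset M].
Proof.
move=> Q inj_f emb path_s uniq_s s_all size_s; have [_ uniq_t _] := bare_t.
have Qp : p \in ~: Q by rewrite !inE; case/andP: uniq_t.
pose g := [ffun x => if x \in vs then nth (f p) (f p :: s) (index x vs) else f x].
have g_nth i : i <= size t -> g (nth p vs i) = nth (f p) (f p :: s) i.
  by move=> le_i; rewrite ffunE mem_nth // index_uniq.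
have g_out x : x \notin t -> g x = f x.
  move=> ntx; rewrite ffunE inE (negbTE ntx) orbF.
  by case: eqP => [->|//]; rewrite /= eqxx.
have vs_mem c : c \in t -> c \in vs by move=> tc; rewrite inE tc orbT.
have g_in x : x \in t -> g x \in avail (~: Q) f.
  move=> tx; rewrite ffunE vs_mem //.
  have nxp : p == x = false by apply: contraTF tx => /eqP<-; case/andP: uniq_t.
  have lt_x : index x t < size s by rewrite size_s index_mem.
  have g_s : nth (f p) s (index x t) \in s by rewrite mem_nth.
  rewrite /= nxp /=; have := s_all (nth (f p) s (index x t)).
  rewrite !inE g_s orbT; case: eqP => // eq_fp.
  by case/andP: uniq_s; rewrite -eq_fp g_s.
have inj_g : injective g.
  move=> x y; have [tx|ntx] := boolP (x \in t); have [ty|nty] := boolP (y \in t).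
  - rewrite !ffunE !vs_mem // => /eqP; rewrite nth_uniq //=; last first.
    + by have := vs_mem y ty; rewrite -index_mem /= size_s.
    + by have := vs_mem x tx; rewrite -index_mem /= size_s.
    move/eqP=> eq_i; rewrite -(nth_index p (vs_mem x tx)) -(nth_index p (vs_mem y ty)).
    by rewrite /= eq_i.
  - move=> eq_g; have := g_in x tx; rewrite eq_g g_out // => Ay.
    by have := avail_mem Ay (_ : y \in ~: Q); rewrite !inE nty eqxx => /(_ isT).
  - move=> eq_g; have := g_in y ty; rewrite -eq_g g_out // => Ax.
    by have := avail_mem Ax (_ : x \in ~: Q); rewrite !inE ntx eqxx => /(_ isT).
  by rewrite !g_out //; apply: inj_f; rewrite !inE.
have M_edge x y : e x y -> [set g x; g y] \in M.
  have step i : i < size t -> [set g (nth p vs i); g (nth p vs i.+1)] \in M.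
    move=> lt_i; rewrite !g_nth ?(ltnW lt_i) //.
    have /(_ i) := pathP (f p) path_s; rewrite size_s => /(_ lt_i).
    by case/andP.
  have pendant c d : c \in t -> e c d -> [set g c; g d] \in M.
    move=> tc e_cd; have [i lt_i [[-> ->]|[-> ->]]] := pendant_edge tc e_cd.
      exact: step.
    by rewrite setUC; apply: step.
  move=> e_xy; have [tx|ntx] := boolP (x \in t); first exact: pendant.
  have [ty|nty] := boolP (y \in t); first by rewrite setUC; apply: pendant; rewrite // sym_e.
  by rewrite !g_out //; apply: emb; rewrite // !inE.
apply/exists_inP; exists [set g @: A | A : {set V} in edge_set e].
  by apply: imset_f; rewrite inE; apply/injectiveP.
apply/subsetP=> _ /imsetP[_ /imsetP[[x y] + ->] ->]; rewrite inE /= => e_xy.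
by rewrite imsetU1 imset_set1; apply: M_edge.
Qed.

End PendantPath.

Lemma pendant_path_wins (V : finType) (e : rel V) (Delta : nat) (p : V) (t : seq V) :
    is_tree e -> max_degree e <= Delta -> bare_path e p t -> leaf e (last p t) ->
    7 * Delta ^ 2 + Delta + 149 <= size t ->
  maker_wins_in (complete_edges #|V|) (copies e #|V|) (#|V| - 1).
Proof.
move=> [[sym_e irr_e] _ conn_e acyc] deg_le bare_t leaf_t t_large.
have [path_t uniq_t _] := bare_t; set Q := [set x in t].
have deg_e v : degree e v <= Delta.
  by apply: leq_trans deg_le; apply: (leq_bigmax (F := degree e)).
have card_Q : #|Q| = size t by rewrite cardsE; apply/card_uniqP; case/andP: uniq_t.
have nQp : p \notin Q by rewrite inE; case/andP: uniq_t.
have V_large : size t < #|V|.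
  by have := max_card (mem (p :: t)); rewrite (card_uniqP uniq_t).
have [n def_n] : exists n, #|V| = n.+1 by exists #|V|.-1; nat_lia.
have card_edges : 2 * (#|V| - 1) <= #|complete_edges #|V| |.
  rewrite /complete_edges card_draws card_ord bin2; nia.
apply: (@wins_from_maker_wins _ _ _ set0) => //.
pose f := fun _ : V => Ordinal (ltn_ord (cast_ord (esym def_n) ord0)).
have card_C : #|~: Q| = 1 + (#|~: Q| - 1).
  by rewrite subnKC // (cardD1 p) inE nQp.
have -> : #|V| - 1 = #|~: Q| - 1 + #|Q| by have := cardsC Q; nat_lia.
have adj0 (T : finType) (a b : T) : adj set0 a b = false by rewrite /adj inE andbF.
apply: (@tree_phase_wins V _ e Delta sym_e irr_e deg_e Q p _ _ _ _ [set p] f) => //.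
- by move=> w x; rewrite !inE => ntw tx; apply: pendant_attach leaf_t _ _ ntw tx.
- apply/card_le1_eqP=> x y; rewrite !inE => /andP[tx e_px] /andP[ty e_py].
  by rewrite (pendant_next sym_e bare_t leaf_t tx e_px)
             (pendant_next sym_e bare_t leaf_t ty e_py).
- case: t path_t t_large @Q {bare_t leaf_t uniq_t card_Q nQp V_large card_C} => [|y t'] /=.
    by nat_lia.
  case/andP=> e_py _ _; apply/card_gt0P; exists y.
  by rewrite !inE eqxx.
- by rewrite card_ord.
- by rewrite card_Q.
- move=> f' M' s inj_f' emb path_s uniq_s s_all.
  apply: (complete_embedding sym_e bare_t leaf_t inj_f' emb path_s uniq_s s_all).
  have nAp : f' p \notin avail (~: Q) f'.
    by rewrite inE negbK; apply: imset_f; rewrite inE.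
  have card_s : size (f' p :: s) = #|avail (~: Q) f'|.+1.
    by rewrite -(card_uniqP uniq_s) (eq_card s_all) cardsU1 nAp.
  apply/eqP; rewrite -eqSS -[(size s).+1]/(size (f' p :: s)) card_s eqSS -card_Q.
  rewrite -(eqn_add2r #|~: Q|) cardsC (card_avail inj_f') card_ord.
  exact: eqxx.
- by rewrite set11.
- by rewrite sub1set inE.
- by move=> x y /set1P-> /set1P->; apply: connect0.
- by move=> x y /set1P-> /set1P->.
- by move=> x y /set1P-> /set1P->; rewrite irr_e.
- rewrite /danger (_ : pairs _ = 0) ?add0n; last first.
    by apply: eq_card0 => c; rewrite !inE /avail_rel adj0 !andbF.
  rewrite big_set1 /excess (_ : blocked _ _ _ _ = 0) ?add0n; last first.
    by apply: eq_card0 => c; rewrite !inE adj0 andbF.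
  have : missing e [set p] p <= degree e p.
    by apply/subset_leq_card/subsetP=> w; rewrite !inE => /andP[].
  by have := deg_e p; case: ifP => // _; nat_lia.
by rewrite cards1.
Qed.

Theorem theorem1p5 :
  forall Delta : nat, 0 < Delta ->
  exists m3 : nat, exists n3 : nat,
  forall n : nat, n3 <= n ->
  forall (V : finType) (e : rel V),
    is_tree e -> #|V| = n -> max_degree e <= Delta ->
    (exists (x : V) (s : seq V),
       [/\ bare_path e x s, size s = m3 & leaf e x \/ leaf e (last x s)]) ->
    maker_wins_in (complete_edges n) (copies e n) (n - 1).
Proof.
move=> Delta _; exists (7 * Delta ^ 2 + Delta + 149), 0.
move=> n _ V e tree_e <- deg_e [x [s [bare_s size_s leaf_s]]].
have [sym_e _] : simple_graph e by case: tree_e.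
case: leaf_s => [leaf_x|leaf_last]; last first.
  by apply: (pendant_path_wins tree_e deg_e bare_s); rewrite ?size_s.
have s_gt0 : 0 < size s by nat_lia.
have [s' [bare_s' size_s' last_s']] := bare_path_rev sym_e s_gt0 bare_s.
by apply: (pendant_path_wins tree_e deg_e bare_s'); rewrite ?last_s' ?size_s' ?size_s.
Qed.
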